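(* Let $G$ be a connected Lie group with Lie algebra $\mathfrak g$, and let $\mathfrak g_0<\mathfrak g_1<\dots<\mathfrak g_n=\mathfrak g$ be a strictly increasing chain of Lie subalgebras. Assume either that $G$ is compact and $\langle\cdot,\cdot\rangle$ is an invariant scalar product on $\mathfrak g$, or that $G$ is semisimple, $\langle\cdot,\cdot\rangle$ is the Killing form, and its restriction to each $\mathfrak g_i$ is non-degenerate. Put $\mathfrak p_0=\mathfrak g_0$ and let $\mathfrak p_i$ be the orthogonal complement of $\mathfrak g_{i-1}$ in $\mathfrak g_i$, $i=1,\dots,n$. Let $s_0,s_1,\dots,s_n$ be arbitrary real numbers, and consider the left-invariant Hamiltonian $$H(x)=\frac{s_0}{2}\langle x_0,x_0\rangle+\frac{s_1}{2}\langle x_1,x_1\rangle+\dots+\frac{s_n}{2}\langle x_n,x_n\rangle,$$ whose Hamiltonian equations on $T^*G\cong G\times\mathfrak g$ are $$\dot x_0=0,\qquad \dot x_i=[(s_i-s_0)x_0+(s_i-s_1)x_1+\dots+(s_i-s_{i-1})x_{i-1},x_i],\quad i=1,\dots,n, \tag{E}$$ $$\dot g=dL_g(s_0x_0+s_1x_1+\dots+s_nx_n). \tag{K}$$ Then: (i) The solution of (E) with initial condition $x(0)=\bar x$ is given by $x_0(t)=\bar x_0=\bar x_{\mathfrak g_0}$ and, for $i=1,\dots,n$, $$x_i(t)=\mathrm{Ad}_{\exp(t(s_1-s_0)\bar x_{\mathfrak g_0})}\circ\mathrm{Ad}_{\exp(t(s_2-s_1)\bar x_{\mathfrak g_1})}\circ\dots\circ\mathrm{Ad}_{\exp(t(s_i-s_{i-1})\bar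 x_{\mathfrak g_{i-1}})}(\bar x_i).$$ (ii) The solution of the corresponding reconstruction problem (K) (with $x(t)$ the solution in (i)) with initial condition $g(0)=\bar g$ is $$g(t)=\bar g\exp(ts_n\bar x)\exp(t(s_{n-1}-s_n)\bar x_{\mathfrak g_{n-1}})\cdots\exp(t(s_1-s_2)\bar x_{\mathfrak g_1})\exp(t(s_0-s_1)\bar x_{\mathfrak g_0}).$$
   Context: For $\xi\in\mathfrak g=\mathfrak p_0\oplus\dots\oplus\mathfrak p_n$ write $\xi_i=\mathrm{pr}_{\mathfrak p_i}\xi$ and $\xi_{\mathfrak g_i}=\xi_0+\dots+\xi_i\in\mathfrak g_i$. The dual $\mathfrak g^*$ is identified with $\mathfrak g$ via $\langle\cdot,\cdot\rangle$, and $T^*G\cong G\times\mathfrak g^*\cong G\times\mathfrak g$ by left trivialization, with coordinates $(g,x)$. $L_g$ denotes left translation by $g$. The subgroups of $G$ corresponding to the $\mathfrak g_i$ are not required to be closed. *)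

(* Defs.v *)
From HB Require Import structures.
From mathcomp Require Import all_boot all_order all_algebra.
From mathcomp Require Import all_classical all_reals all_analysis.

Set Implicit Arguments.
Unset Strict Implicit.
Unset Printing Implicit Defensive.
Import Order.TTheory GRing.Theory Num.Theory.
Import numFieldNormedType.Exports.
Local Open Scope classical_set_scope.
Local Open Scope ring_scope.

(* Smooth maps on an open subset [U] of a finite-dimensional normed space:
   all iterated directional derivatives exist, are (Frechet) differentiable
   and continuous on [U]. *)
Fixpoint Ck_on (R : realType) (V W : normedModType R) (k : nat) (U : set V)
    (f : V -> W) : Prop :=
  match k with
  | 0 => forall x, U x -> {for x, continuous f}
  | k'.+1 => (forall x, U x -> differentiable f x) /\
             (forall v, Ck_on k' U ('D_v f))
  end.

Definition smooth_on (R : realType) (V W : normedModType R) (U : set V)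
    (f : V -> W) : Prop :=
  forall k, Ck_on k U f.

(* A chart is a homeomorphism of an open set [cdom] onto an open subset of R^d;
   [cmap] and [cinv] are total functions, meaningful only on [cdom] and
   [cmap @` cdom]. *)
Record chart (R : realType) (d : nat) (M : topologicalType) := Chart {
  cdom : set M;
  cmap : M -> 'rV[R]_d;
  cinv : 'rV[R]_d -> M;
  cdom_open : open cdom;
  cimg_open : open (cmap @` cdom);
  cmapK : forall x, cdom x -> cinv (cmap x) = x;
  cmap_continuous : forall x, cdom x -> {for x, continuous cmap};
  cinv_continuous : forall u, (cmap @` cdom) u -> {for u, continuous cinv}
}.

(* [chart_at x] is a preferred chart around [x]; it is used below to represent
   the tangent space at [x] by the model space R^d. *)
HB.mixin Record isManifold (R : realType) (d : nat) M of Topological M := {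
  manifold_hausdorff : hausdorff_space M;
  manifold_second_countable : @second_countable M;
  atlas : set (chart R d M);
  chart_at : M -> chart R d M;
  chart_at_atlas : forall x, atlas (chart_at x);
  chart_at_dom : forall x, cdom (chart_at x) x;
  transition_smooth : forall c c', atlas c -> atlas c' ->
    smooth_on (cmap c @` (cdom c `&` cdom c')) (cmap c' \o cinv c)
}.

#[short(type="manifoldType")]
HB.structure Definition Manifold (R : realType) (d : nat) :=
  {M of Topological M & isManifold R d M}.

Definition smooth_map (R : realType) (d e : nat) (M : manifoldType R d)
    (N : manifoldType R e) (f : M -> N) : Prop :=
  continuous f /\
  forall (c : chart R d M) (c' : chart R e N), atlas c -> atlas c' ->
    smooth_on (cmap c @` (cdom c `&` f @^-1` cdom c'))
              (cmap c' \o f \o cinv c).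

(* Smoothness of a map of two variables, i.e. on the product manifold, whose
   charts are the products of charts. *)
Definition smooth_map2 (R : realType) (d1 d2 e : nat) (M1 : manifoldType R d1)
    (M2 : manifoldType R d2) (N : manifoldType R e) (f : M1 -> M2 -> N) : Prop :=
  continuous (fun z : M1 * M2 => f z.1 z.2) /\
  forall (c1 : chart R d1 M1) (c2 : chart R d2 M2) (c' : chart R e N),
    atlas c1 -> atlas c2 -> atlas c' ->
    smooth_on
      ((fun z : M1 * M2 => (cmap c1 z.1, cmap c2 z.2)) @`
         [set z | [/\ cdom c1 z.1, cdom c2 z.2 & cdom c' (f z.1 z.2)]])
      (fun w : 'rV[R]_d1 * 'rV[R]_d2 =>
         cmap c' (f (cinv c1 w.1) (cinv c2 w.2))).

#[short(type="groupManifoldType")]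
HB.structure Definition GroupManifold (R : realType) (d : nat) :=
  {G of Manifold R d G & Group G}.

HB.mixin Record isLieGroup (R : realType) (d : nat) G of GroupManifold R d G := {
  mulg_smooth : smooth_map2 (fun g h : G => (g * h)%g);
  invg_smooth : smooth_map (fun g : G => (g^-1)%g)
}.

#[short(type="lieGroupType")]
HB.structure Definition LieGroup (R : realType) (d : nat) :=
  {G of GroupManifold R d G & isLieGroup R d G}.

Section LieGroupTheory.
Variables (R : realType) (d : nat) (G : lieGroupType R d).
Implicit Types (g : G) (v w : 'rV[R]_d).

(* The tangent map T_gG -> T_{f g}G, both spaces being R^d through [chart_at].
   In particular 'rV[R]_d, read in the chart at 1, is the Lie algebra T_1G. *)
Definition tangent_map (f : G -> G) g : 'rV[R]_d -> 'rV[R]_d :=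
  'd (cmap (chart_at (f g)) \o f \o cinv (chart_at g)) (cmap (chart_at g) g).

(* Continuity is required since [cmap] is arbitrary outside the chart domain. *)
Definition has_velocity (c : R -> G) (t : R) v : Prop :=
  {for t, continuous c} /\ is_derive t 1 (cmap (chart_at (c t)) \o c) v.

Definition dL g : 'rV[R]_d -> 'rV[R]_d := tangent_map (fun h => (g * h)%g) 1%g.

Definition Ad g : 'rV[R]_d -> 'rV[R]_d :=
  tangent_map (fun h => (g * h * g^-1)%g) 1%g.

(* [v, w] = ad v w, where ad = T_1 Ad. *)
Definition lie_bracket v w : 'rV[R]_d :=
  'd (fun u => Ad (cinv (chart_at (1%g : G)) u) w)
     (cmap (chart_at (1%g : G)) 1%g) v.

Definition one_parameter_subgroup v (c : R -> G) : Prop :=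
  (forall s t, c (s + t) = (c s * c t)%g) /\ has_velocity c 0 v.

Definition lie_exp v : G :=
  xget 1%g [set g | exists2 c, one_parameter_subgroup v c & g = c 1].

Definition lie_subalgebra (U : {vspace 'rV[R]_d}) : Prop :=
  forall v w, v \in U -> w \in U -> lie_bracket v w \in U.

Definition lie_ideal (U : {vspace 'rV[R]_d}) : Prop :=
  forall v w, w \in U -> lie_bracket v w \in U.

Definition derived_algebra (U : {vspace 'rV[R]_d}) : {vspace 'rV[R]_d} :=
  <<[seq lie_bracket v w | v <- vbasis U, w <- vbasis U]>>%VS.

Definition lie_solvable (U : {vspace 'rV[R]_d}) : Prop :=
  exists k, iter k derived_algebra U = 0%VS.

Definition lie_semisimple : Prop :=
  forall U, lie_ideal U -> lie_solvable U -> U = 0%VS.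

Definition killing_form v w : R :=
  \tr (lin1_mx (lie_bracket v \o lie_bracket w)).

Definition invariant_scalar_product (B : 'rV[R]_d -> 'rV[R]_d -> R) : Prop :=
  [/\ forall a v v' w, B (a *: v + v') w = a * B v w + B v' w,
      forall v w, B v w = B w v,
      forall v, v != 0 -> 0 < B v v
    & forall g v w, B (Ad g v) (Ad g w) = B v w].

Definition nondegenerate_on (B : 'rV[R]_d -> 'rV[R]_d -> R)
    (U : {vspace 'rV[R]_d}) : Prop :=
  forall v, v \in U -> (forall w, w \in U -> B v w = 0) -> v = 0.

(* The canonical symplectic form of T^*G at [(g, x)], in the left
   trivialization T^*G = G x g (with g^* = g through [B]); a tangent vector is
   a pair [(xi, nu)] standing for [(dL g xi, nu)]. It is - d theta for the
   Liouville form theta (xi, nu) = B x xi, and does not depend on [g]. *)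
Definition canonical_form (B : 'rV[R]_d -> 'rV[R]_d -> R) (x : 'rV[R]_d)
    (a b : 'rV[R]_d * 'rV[R]_d) : R :=
  B b.2 a.1 - B a.2 b.1 + B x (lie_bracket a.1 b.1).

(* Integral curves of the Hamiltonian vector field of the left-invariant
   function (g, x) |-> H x, whose differential at [(xi, nu)] is 'D_nu H x. *)
Definition hamiltonian_curve (B : 'rV[R]_d -> 'rV[R]_d -> R)
    (H : 'rV[R]_d -> R) (g : R -> G) (x : R -> 'rV[R]_d) : Prop :=
  forall t : R, exists xi nu : 'rV[R]_d,
    [/\ has_velocity g t (dL (g t) xi),
        is_derive t 1 x nu
      & forall b : 'rV[R]_d * 'rV[R]_d,
          canonical_form B (x t) (xi, nu) b = 'D_(b.2) H (x t)].

Section Chain.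
Variables (n : nat) (p : nat -> {vspace 'rV[R]_d}) (s : nat -> R).

(* Projection onto [p i] along the other summands of p 0 + ... + p n, for a
   direct sum. *)
Definition chain_pr (i : nat) (x : 'rV[R]_d) : 'rV[R]_d :=
  sumv_pi (\sum_(0 <= j < n.+1) p j)%VS i x.

Definition chain_sub (i : nat) (x : 'rV[R]_d) : 'rV[R]_d :=
  \sum_(0 <= j < i.+1) chain_pr j x.

Definition chain_hamiltonian (B : 'rV[R]_d -> 'rV[R]_d -> R)
    (x : 'rV[R]_d) : R :=
  \sum_(0 <= i < n.+1) s i / 2 * B (chain_pr i x) (chain_pr i x).

Definition solves_reduced (x : R -> 'rV[R]_d) : Prop :=
  (forall t : R, is_derive t 1 (chain_pr 0 \o x) 0) /\
  (forall i (t : R), (0 < i <= n)%N ->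
     is_derive t 1 (chain_pr i \o x)
       (lie_bracket (\sum_(0 <= j < i) (s i - s j) *: chain_pr j (x t))
                    (chain_pr i (x t)))).

Definition solves_kinematic (x : R -> 'rV[R]_d) (g : R -> G) : Prop :=
  forall t, has_velocity g t
    (dL (g t) (\sum_(0 <= j < n.+1) s j *: chain_pr j (x t))).

(* The product over [rev (iota 0 n)] is ordered, with k = n - 1, ..., 1, 0
   from left to right. *)
Definition reconstruction (gbar : G) (xbar : 'rV[R]_d) (t : R) : G :=
  (gbar * lie_exp ((t * s n) *: xbar) *
   \prod_(k <- rev (iota 0 n))
      lie_exp ((t * (s k - s k.+1)) *: chain_sub k xbar))%g.

End Chain.

End LieGroupTheory.

Arguments lie_bracket {R d} G v w.
Arguments lie_exp {R d} G v.
Arguments lie_subalgebra {R d} G U.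
Arguments lie_semisimple {R d} G.
Arguments killing_form {R d} G v w.
Arguments invariant_scalar_product {R d} G B.
Arguments canonical_form {R d} G B x a b.

(* Main.v *)
Require Import Defs.
From HB Require Import structures.
From mathcomp Require Import all_boot all_order all_algebra.
From mathcomp Require Import all_classical all_reals all_analysis.
From mathcomp Require Import ring lra.
Set Implicit Arguments.
Unset Strict Implicit.
Unset Printing Implicit Defensive.
Import Order.TTheory GRing.Theory Num.Theory.
Import numFieldNormedType.Exports.
Local Open Scope classical_set_scope.
Local Open Scope ring_scope.

(** Every curve in G is studied through its left velocity v, given by
    c' = dL_c v; two curves with the same left velocities and the same initial
    point coincide, because the quotient a b^-1 has velocity zero.  One-parameter
    subgroups come from Picard-Lindelof in the chart at 1, followed by
    c(t) = c(t/N)^N.  From Ad (exp tv) v = v one gets the antisymmetry of the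
    bracket, and from the fact that Ad g is an automorphism of it one gets the
    invariance of the Killing form, so both cases of the theorem reduce to an
    Ad-invariant form that is nondegenerate on each g_i.

    With eta_k = (s_{k+1} - s_k) xbar_{g_k} and A_k(t) = Ad (exp (t eta_k)),
    the curve x_i = A_0 ... A_{i-1} xbar_i satisfies
    x_i' = sum_{k<i} [A_0 ... A_{k-1} eta_k, x_i].  As A_k fixes xbar_{g_k}, the
    vector A_0 ... A_k xbar_{g_k} is x_0 + ... + x_k, and summation by parts gives
    the reduced equation.  The same telescoping computes the left velocity of the
    product in (ii), one factor at a time. *)

(** * Calculus in finite-dimensional spaces *)

Section Calculus.
Context {R : realType}.

(** The subgroups attached to the g_i may fail to be closed, so no subgroup is ever formed:
    stability of p_i under Ad (exp v), for v in g_j with j < i, is deduced from the inclusion of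
    [g_j, p_i] in p_i through a linear differential equation. Tangent spaces at different points are
    copies of R^d read in unrelated charts, and [cmap], [cinv] are meaningless off their domains;
    tangent maps are therefore identified by computing the velocity of one curve in two ways, and
    chart formulas are used only near a point. Two derivatives of the multiplication enter: one
    gives the left-invariant fields and Ad, the other makes these fields locally Lipschitz and Ad
    differentiable. On the Hamiltonian side, nondegeneracy on g_n = g turns the symplectic condition
    into the Euler equation x' = [x, omega], where omega is the gradient of H. *)

Lemma is_derive_diff_comp (V W : normedModType R) (f : V -> W) (u : R -> V)
    (t : R) (v : V) :
  is_derive t 1 u v -> differentiable f (u t) ->
  is_derive t 1 (f \o u) ('d f (u t) v).
Proof.
move=> [du <-] df; have du' := (derivable1_diffP _ _).1 du.
have dfu := differentiable_comp du' df.
by split; [exact/derivable1_diffP | rewrite deriveE// diff_comp//= deriveE].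
Qed.

Lemma linear_rV_sum (W : lmodType R) m (f : {linear 'rV[R]_m -> W}) x :
  f x = \sum_(i < m) x ord0 i *: f (delta_mx ord0 i).
Proof. by rewrite {1}(row_sum_delta x) linear_sum; under eq_bigr do rewrite linearZ. Qed.

Lemma linear_rV_differentiable (W : normedModType R) m
  (f : {linear 'rV[R]_m -> W}) x : differentiable f x.
Proof.
have -> : (f : 'rV[R]_m -> W) =
    \sum_(i < m) (fun x : 'rV[R]_m => x ord0 i *: f (delta_mx ord0 i)).
  by apply/funext => y; rewrite linear_rV_sum fct_sumE.
by apply: differentiable_sum => i; apply: differentiableZl; exact: differentiable_coord.
Qed.

Lemma is_derive_linear (W : normedModType R) m
    (f : {linear 'rV[R]_m -> W}) (u : R -> 'rV[R]_m) (t : R) v :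
  is_derive t 1 u v -> is_derive t 1 (f \o u) (f v).
Proof.
move=> du; have df := @linear_rV_differentiable W m f (u t).
have := is_derive_diff_comp du df; rewrite diff_lin//.
by move=> x; apply: differentiable_continuous; exact: linear_rV_differentiable.
Qed.

Lemma is_derive_rV m (u : R -> 'rV[R]_m) (t : R) v :
  is_derive t 1 u v <-> forall i, is_derive t 1 (fun x => u x ord0 i) (v ord0 i).
Proof.
split=> [[du <-] i|H].
  split; first exact: ((derivable_mxP _ _ _).1 du).
  by rewrite derive_mx// mxE.
have du : derivable u t 1.
  by apply/derivable_mxP => i j; rewrite (ord1 i); exact: ex_derive.
split=> //; rewrite derive_mx//; apply/rowP => j; rewrite mxE.
exact: derive_val.
Qed.

Lemma rV_norm_le m (x : 'rV[R]_m) (M : R) : 0 <= M ->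
  (forall i, `|x ord0 i| <= M) -> `|x| <= M.
Proof.
move=> M0 H; rewrite /Num.Def.normr/= mx_normrE; apply: bigmax_le => // -[i j] _ /=.
by rewrite (ord1 i).
Qed.

Lemma rV_coord_le m (x : 'rV[R]_m) i : `|x ord0 i| <= `|x|.
Proof.
by rewrite [leRHS]/Num.Def.normr/= mx_normrE; exact: (le_bigmax _ _ (ord0, i)).
Qed.

(** The integral starts at a finite [a], so the derivative is obtained only to the right of [a]; the
    Picard iteration places [a] to the left of its time interval. *)
Lemma antiderivative (f : R -> R) (a : R) : continuous f ->
  exists F : R -> R, forall t, a < t -> is_derive t 1 F (f t).
Proof.
move=> cf.
exists (fun x => \int[lebesgue_measure]_(t in [set` `[a, x]]) (f t))%R => t at_.
have ti : (t < t + 1)%R by rewrite ltrDl.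
have [|dF eF] := @continuous_FTC1_closed R f a t (t + 1) ti _ at_ (cf t).
  apply: continuous_compact_integrable; first exact: segment_compact.
  exact: continuous_subspaceT.
by apply: DeriveDef; [exact: dF|rewrite -derive1E; exact: eF].
Qed.

Lemma antiderivative_rV m (f : R -> 'rV[R]_m) (a : R) : continuous f ->
  exists F : R -> 'rV[R]_m, forall t, a < t -> is_derive t 1 F (f t).
Proof.
move=> cf.
have H i : exists F : R -> R, forall t, a < t -> is_derive t 1 F (f t ord0 i).
  apply: (@antiderivative (fun t => f t ord0 i)) => t.
  apply: (@continuous_comp _ _ _ f (fun x : 'rV[R]_m => x ord0 i)); first exact: cf.
  exact: coord_continuous.
have [F HF] := choice H.
exists (fun t => \row_i F i t) => t at_; apply/is_derive_rV => i.
by under eq_fun do rewrite mxE; exact: HF.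
Qed.

(** The norm of row vectors is the maximum norm, so the scalar mean value theorem in each coordinate
    gives the bound with the same [M]. *)
Lemma derive_norm_le m (u du : R -> 'rV[R]_m) (M a b : R) :
  (forall t, Num.min a b <= t <= Num.max a b -> is_derive t 1 u (du t)) ->
  (forall t, Num.min a b <= t <= Num.max a b -> `|du t| <= M) ->
  `|u b - u a| <= M * `|b - a|.
Proof.
wlog ab : a b / a <= b => [hw|].
  case/orP: (le_total a b) => ab; first exact: hw.
  by rewrite minC maxC distrC [`|b - a|]distrC; exact: hw.
rewrite min_l// max_r// => Hd HM.
have M0 : 0 <= M by apply: le_trans (HM a _); rewrite ?lexx.
apply: rV_norm_le => [|i]; first by rewrite mulr_ge0.
have [x xab ] : exists2 x, x \in `[a, b]%R &
    u b ord0 i - u a ord0 i = du x ord0 i * (b - a).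
  apply: (@MVT_segment _ (fun t => u t ord0 i)) => //.
    move=> x; rewrite in_itv/= => /andP[/ltW ax /ltW xb].
    by apply: ((is_derive_rV u x (du x)).1 _ i); apply: Hd; rewrite ax.
  apply: derivable_within_continuous => x; rewrite in_itv/= => xab.
  by have [] := (is_derive_rV u x (du x)).1 (Hd x xab) i.
rewrite !mxE => ->; rewrite normrM ler_wpM2r//.
by rewrite (le_trans (rV_coord_le _ _))// HM// -in_itv.
Qed.

Lemma derive0_cst m (u : R -> 'rV[R]_m) (a b : R) :
  (forall t, Num.min a b <= t <= Num.max a b -> is_derive t 1 u 0) -> u b = u a.
Proof.
move=> H; apply/eqP; rewrite -subr_eq0 -normr_le0.
have := @derive_norm_le m u (fun=> 0) 0 a b H.
by rewrite mul0r; apply => t _; rewrite normr0.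
Qed.

Lemma is_derive_scale m (k : R -> R) (u : R -> 'rV[R]_m) (t dk : R) du :
  is_derive t 1 k dk -> is_derive t 1 u du ->
  is_derive t 1 (fun t => k t *: u t) (k t *: du + dk *: u t).
Proof.
move=> Hk /is_derive_rV Hu; apply/is_derive_rV => i.
have -> : (fun x => (k x *: u x) ord0 i) = k * (fun x => u x ord0 i).
  by apply/funext => x; rewrite mxE.
apply: is_derive_eq; rewrite !mxE; congr (_ + _).
by rewrite mulrC.
Qed.

Lemma is_derive_bigsum m (I : Type) (r : seq I) (P : pred I) (u : I -> R -> 'rV[R]_m)
    du (t : R) :
  (forall i, P i -> is_derive t 1 (u i) (du i)) ->
  is_derive t 1 (fun t => \sum_(i <- r | P i) u i t) (\sum_(i <- r | P i) du i).
Proof.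
move=> H; elim: r => [|i r IH].
  by rewrite big_nil; under eq_fun do rewrite big_nil; exact: is_derive_cst.
rewrite big_cons; under eq_fun do rewrite big_cons.
by case: ifP => // Pi; apply: is_deriveD => //; exact: H.
Qed.

Lemma is_derive_affine m (w y : 'rV[R]_m) (t : R) :
  is_derive t 1 (fun t => t *: w + y) w.
Proof.
have H := is_deriveD (is_derive_scale (is_derive_id t 1) (is_derive_cst w t 1))
  (is_derive_cst y t 1).
apply: is_derive_eq H _.
by rewrite scaler0 add0r addr0 scale1r.
Qed.

(** The segment from y to x stays in the ball by convexity, and the derivative along it is a
    combination of m partial derivatives, whence the factor m. *)
Lemma partial_bounded_lipschitz m k (f : 'rV[R]_m -> 'rV[R]_k) x0 (r M : R) :
  (forall x, `|x - x0| <= r -> differentiable f x) ->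
  (forall x i, `|x - x0| <= r -> `|'D_(delta_mx ord0 i) f x| <= M) ->
  forall x y, `|x - x0| <= r -> `|y - x0| <= r ->
   `|f x - f y| <= (M *+ m) * `|x - y|.
Proof.
move=> df HM x y xr yr.
pose c (t : R) := t *: (x - y) + y.
have cr t : 0 <= t <= 1 -> `|c t - x0| <= r.
  move=> /andP[t0 t1].
  have -> : c t - x0 = t *: (x - x0) + (1 - t) *: (y - x0).
    by rewrite /c; apply/rowP => i; rewrite !mxE; ring.
  apply: le_trans (ler_normD _ _) _; rewrite !normrZ ger0_norm// [`|1 - t|]ger0_norm ?subr_ge0//.
  have -> : r = t * r + (1 - t) * r by ring.
  by rewrite lerD// ler_wpM2l// subr_ge0.
have := @derive_norm_le _ (f \o c) (fun t => 'd f (c t) (x - y)) ((M *+ m) * `|x - y|) 0 1.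
rewrite min_l// max_r//.
rewrite /c /= scale0r scale1r add0r subrK subr0 normr1 mulr1; apply => t t01.
  by apply: is_derive_diff_comp; [exact: is_derive_affine|exact/df/cr].
have -> : M *+ m = \sum_(i < m) M by rewrite sumr_const card_ord.
rewrite linear_rV_sum mulr_suml.
apply: le_trans (ler_norm_sum _ _ _) _; apply: ler_sum => i _.
rewrite normrZ mulrC ler_pM// ?rV_coord_le//.
by rewrite -deriveE; [exact/HM/cr|exact/df/cr].
Qed.

Lemma C1_locally_lipschitz m k (f : 'rV[R]_m -> 'rV[R]_k) (U : set 'rV[R]_m) x0 :
  open U -> U x0 -> (forall x, U x -> differentiable f x) ->
  (forall v x, U x -> {for x, continuous ('D_v f)}) ->
  exists r L : R, [/\ 0 < r, 0 <= L, (forall x, `|x - x0| <= r -> U x) &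
    forall x y, `|x - x0| <= r -> `|y - x0| <= r -> `|f x - f y| <= L * `|x - y|].
Proof.
move=> oU Ux0 df cf.
(* The sum dominates every partial derivative at [x0]; the extra 1 leaves room for their variation
   near [x0]. *)
pose M : R := 1 + \sum_(i < m) `|'D_(delta_mx ord0 i) f x0|.
have Hn : \forall x \near x0, U x /\ forall i : 'I_m, `|'D_(delta_mx ord0 i) f x| <= M.
  near=> x; split.
    by near: x; exact: open_nbhs_nbhs.
  near: x; apply: filter_forall => i.
  have := cf (delta_mx ord0 i) _ Ux0; move/cvg_norm => /cvgrPdist_lt/(_ _ ltr01).
  apply: filterS => x; rewrite ltr_distlC => /andP[_ /ltW h].
  apply: (le_trans h); rewrite [M]addrC lerD2r (bigD1 i)//= lerDl.
  by apply: sumr_ge0.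
have /nbhs_ballP[r0 /= r00 Hr] := Hn.
have r0p : 0 < r0 / 2 by rewrite divr_gt0.
have Hb x : `|x - x0| <= r0 / 2 -> ball x0 r0 x.
  move=> h; rewrite -ball_normE /= distrC (le_lt_trans h)//.
  by rewrite ltr_pdivrMr// ltr_pMr// ltr1n.
exists (r0 / 2), (M *+ m); split => //.
- by rewrite mulrn_wge0// addr_ge0// sumr_ge0.
- by move=> x /Hb/Hr[].
- apply: partial_bounded_lipschitz => [x /Hb/Hr[/df]//|x i /Hb/Hr[_]]; exact.
Unshelve. all: by end_near. Qed.

End Calculus.

Lemma is_derive_pair (R : realType) (V W : normedModType R) (u : R -> V) (w : R -> W)
    (t : R) v z : is_derive t 1 u v -> is_derive t 1 w z ->
  is_derive t 1 (fun s => (u s, w s)) (v, z).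
Proof.
move=> [du <-] [dw <-]; have du' := (derivable1_diffP _ _).1 du.
have dw' := (derivable1_diffP _ _).1 dw.
have dp := differentiable_pair du' dw'.
split; first exact/derivable1_diffP.
by rewrite deriveE// diff_pair//= !deriveE.
Qed.

(** The difference g - f vanishes near x, so it is differentiable there with differential zero. Maps
    read in charts agree with their intended formulas only locally. *)
Lemma near_eq_differentiable (R : realType) (V W : normedModType R) (f g : V -> W) x :
  (\near x, f x = g x) -> differentiable f x -> differentiable g x.
Proof.
move=> fg df.
have z0 : \forall h \near 0, (g - f) (h + x) = 0.
  have : \forall y \near x, (g - f) y = 0.
    by apply: filterS fg => y; rewrite !fctE => ->; rewrite subrr.
  rewrite (near_shift 0 x) /=; apply: filterS => h /=; rewrite subr0; exact.
have gfE : (g - f) \o shift x = cst ((g - f) x) + (\0 : V -> W) +o_ 0 id.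
  apply/eqaddoP => e e0; near=> h.
  have -> : ((g - f) \o shift x - (cst ((g - f) x) + (\0 : V -> W))) h = 0.
    rewrite !fctE /= addr0; have : (g - f) (h + x) = 0 by near: h.
    have := nbhs_singleton fg; rewrite !fctE => -> ->; by rewrite subrr subrr.
  by rewrite normr0 mulr_ge0// ltW.
have c0 : continuous (\0 : V -> W) by move=> ?; exact: cvg_cst.
have dz : differentiable (g - f) x.
  apply/diff_locallyP; rewrite (@diff_unique _ _ _ _ (\0 : {linear V -> W}) x)//.
have -> : g = f + (g - f) by apply/funext => y; rewrite !fctE addrC subrK.
exact: differentiableD.
Unshelve. all: by end_near. Qed.

Lemma differentiable_rV (R : realType) (V : normedModType R) m (f : V -> 'rV[R]_m) x :
  (forall i, differentiable (fun y => f y ord0 i) x) -> differentiable f x.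
Proof.
move=> H.
have -> : f = \sum_(i < m) (fun y => f y ord0 i *: delta_mx ord0 i).
  by apply/funext => y; rewrite fct_sumE {1}(row_sum_delta (f y)).
by apply: differentiable_sum => i; exact: differentiableZl.
Qed.

Lemma differentiable_scale (R : realType) (V : normedModType R) m (k : V -> R)
    (f : V -> 'rV[R]_m) x :
  differentiable k x -> differentiable f x -> differentiable (fun y => k y *: f y) x.
Proof.
move=> dk df; apply: differentiable_rV => i.
have -> : (fun y => (k y *: f y) ord0 i) = k * (fun y => f y ord0 i).
  by apply/funext => y; rewrite mxE.
apply: differentiableM => //.
exact: (differentiable_comp df (differentiable_coord _ _ _)).
Qed.

Lemma is_derive_uniq (R : realType) (V W : normedModType R) (f g : V -> W) x v a b :
  is_derive x v f a -> is_derive x v g b -> f =1 g -> a = b.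
Proof. by move=> [_ <-] [_ <-] /funext ->. Qed.

Lemma derive_line (R : realType) (V W : normedModType R) (f : V -> W) x v :
  'D_v f x = 'D_1 (fun h : R => f (h *: v + x)) 0.
Proof.
rewrite /derive; set g1 := fun h => h^-1 *: _; set g2 := fun h => h^-1 *: _.
suff -> : g1 = g2 by [].
by apply/funext => h; rewrite /g1 /g2 /= addr0 scale0r add0r [_%:A]mulr1.
Qed.

(** * Ordinary differential equations *)

Section Picard.
Context {R : realType}.

(** For r >= 0, the nearest-point retraction of the line onto [c - r, c + r]. Applied in each
    coordinate it retracts onto a ball of the maximum norm. *)
Definition clip (r c x : R) : R := Num.max (c - r) (Num.min (c + r) x).

Lemma clip_bounds r c x : 0 <= r -> `|clip r c x - c| <= r.
Proof.
move=> r0; have : c - r <= clip r c x <= c + r.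
  rewrite /clip le_max lexx/= ge_max ge_min lexx/= andbT; lra.
by rewrite ler_norml => /andP[h1 h2]; apply/andP; split; lra.
Qed.

Lemma clip_id r c x : `|x - c| <= r -> clip r c x = x.
Proof.
rewrite ler_norml => /andP[h1 h2].
by rewrite /clip min_r ?max_r//; lra.
Qed.

Lemma clip_lipschitz r c x y : `|clip r c x - clip r c y| <= `|x - y|.
Proof.
wlog xy : x y / x <= y => [hw|].
  case/orP: (le_total x y) => h; first exact: hw.
  by rewrite distrC [leRHS]distrC; exact: hw.
rewrite distrC [leRHS]distrC [leRHS]ger0_norm ?subr_ge0//.
rewrite /clip; case: (lerP (c + r) x) => h1; case: (lerP (c + r) y) => h2;
  rewrite ?subrr ?normr0 ?subr_ge0//; [lra| |].
- case: (lerP (c - r) (c + r)); case: (lerP (c - r) x) => h3 h4;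
  rewrite ?subrr ?normr0 ?subr_ge0// ger0_norm; lra.
- case: (lerP (c - r) y); case: (lerP (c - r) x) => h3 h4;
  rewrite ?subrr ?normr0 ?subr_ge0// ger0_norm; lra.
Qed.

Lemma le_add_geometric (x y C : R) : 0 <= C ->
  (forall k, x <= y + C / 2 ^+ k) -> x <= y.
Proof.
move=> C0 H; apply/ler_addgt0Pr => e e0.
have Ce : 0 <= C / e by rewrite divr_ge0// ltW.
apply: le_trans (H (Num.truncn (C / e)).+1) _; rewrite lerD2l.
rewrite ler_pdivrMr ?exprn_gt0// -ler_pdivrMl// mulrC.
apply: le_trans (ltW (truncnS_gt _)) _.
by rewrite -natrX ler_nat ltnW// ltn_expl.
Qed.

(** Nested intervals: 2r / 2^n is the sum of the tail of the series r / 2^k from k = n on, so the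
    intervals of that radius around a_n decrease, and the supremum of their left ends lies in all of
    them. *)
Lemma geometric_limit (a : nat -> R) (r : R) : 0 <= r ->
  (forall n, `|a n.+1 - a n| <= r / 2 ^+ n) ->
  exists l, forall n, `|l - a n| <= r *+ 2 / 2 ^+ n.
Proof.
move=> r0 H.
pose b n := a n - r *+ 2 / 2 ^+ n.
pose c n := a n + r *+ 2 / 2 ^+ n.
have half n : r *+ 2 / 2 ^+ n.+1 = r / 2 ^+ n :> R.
  rewrite -mulr_natr exprS; field.
  by rewrite expf_neq0.
have dbl n : r *+ 2 / 2 ^+ n = r / 2 ^+ n + r / 2 ^+ n.
  by rewrite -mulrDl mulr2n.
have bS n : b n <= b n.+1.
  rewrite /b half dbl; have := H n; rewrite ler_norml => /andP[h _]; lra.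
have cS n : c n.+1 <= c n.
  rewrite /c half dbl; have := H n; rewrite ler_norml => /andP[_ h]; lra.
have bm m n : (m <= n)%N -> b m <= b n by move=> mn; apply: (nondecreasing_seqP b).1.
have cm m n : (m <= n)%N -> c n <= c m by move=> mn; apply: (nonincreasing_seqP c).1.
have bc m n : b m <= c n.
  apply: le_trans (bm _ _ (leq_maxl _ n)) _.
  apply: le_trans _ (cm _ _ (leq_maxr m _)).
  have : 0 <= r *+ 2 / 2 ^+ maxn m n.
    by rewrite divr_ge0 ?exprn_ge0 ?mulrn_wge0.
  rewrite /b /c; lra.
have bs : has_sup (range b).
  by split; [exists (b 0%N); exists 0%N|exists (c 0%N) => _ [n _ <-]].
exists (sup (range b)) => n.
have h1 : b n <= sup (range b) by apply: sup_upper_bound => //; exists n.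
have h2 : sup (range b) <= c n by apply: ge_sup; [case: bs|move=> _ [k _ <-]].
by move: h1 h2; rewrite /b /c ler_norml => h1 h2; apply/andP; split; lra.
Qed.

Lemma geometric_limit_rV m (a : nat -> 'rV[R]_m) (r : R) : 0 <= r ->
  (forall n, `|a n.+1 - a n| <= r / 2 ^+ n) ->
  exists l, forall n, `|l - a n| <= r *+ 2 / 2 ^+ n.
Proof.
move=> r0 H.
have Hi i : exists l, forall n, `|l - a n ord0 i| <= r *+ 2 / 2 ^+ n.
  apply: geometric_limit => // n; apply: le_trans (H n).
  by have := rV_coord_le (a n.+1 - a n) i; rewrite !mxE.
have [l Hl] := choice Hi; exists (\row_i l i) => n.
apply: rV_norm_le; first by rewrite divr_ge0 ?exprn_ge0 ?mulrn_wge0.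
by move=> i; rewrite !mxE.
Qed.

Lemma lipschitz_continuous (V W : normedModType R) (f : V -> W) (K : R) :
  (forall x y, `|f x - f y| <= K * `|x - y|) -> continuous f.
Proof.
move=> H x; apply/cvgrPdist_lt => e e0; near=> y.
apply: le_lt_trans (H _ _) _.
have K0 : 0 < `|K| + 1 by rewrite ltr_wpDl.
apply: (@le_lt_trans _ _ ((`|K| + 1) * `|x - y|)).
  by rewrite ler_wpM2r// (le_trans (ler_norm _))// lerDl.
rewrite -ltr_pdivlMl//; near: y; apply: cvgr_dist_lt => //.
by rewrite mulrC divr_gt0.
Unshelve. all: by end_near. Qed.

Variables (m : nat) (f : 'rV[R]_m -> 'rV[R]_m) (x0 : 'rV[R]_m) (r L : R).
Hypotheses (r0 : 0 < r) (L0 : 0 <= L).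
Hypothesis fL : forall x y, `|x - x0| <= r -> `|y - x0| <= r ->
  `|f x - f y| <= L * `|x - y|.

Let clipV (x : 'rV[R]_m) : 'rV[R]_m := \row_i clip r (x0 ord0 i) (x ord0 i).

Let clipV_ball x : `|clipV x - x0| <= r.
Proof.
by apply: rV_norm_le => [|i]; [exact: ltW|rewrite !mxE; exact/clip_bounds/ltW].
Qed.

Let clipV_id x : `|x - x0| <= r -> clipV x = x.
Proof.
move=> h; apply/rowP => i; rewrite mxE; apply: clip_id.
by have := rV_coord_le (x - x0) i; rewrite !mxE => /le_trans; exact.
Qed.

Let clipV_lipschitz x y : `|clipV x - clipV y| <= `|x - y|.
Proof.
apply: rV_norm_le => // i; rewrite !mxE; apply: le_trans (clip_lipschitz _ _ _ _) _.
by have := rV_coord_le (x - y) i; rewrite !mxE.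
Qed.

Let F x := f (clipV x).

Let FL x y : `|F x - F y| <= L * `|x - y|.
Proof.
apply: le_trans (fL (clipV_ball _) (clipV_ball _)) _.
by rewrite ler_wpM2l// clipV_lipschitz.
Qed.

Let K := `|f x0| + L * r.

Let FK x : `|F x| <= K.
Proof.
rewrite -[F x](subrK (f x0)); apply: le_trans (ler_normD _ _) _.
rewrite addrC lerD2l; apply: le_trans (fL (clipV_ball _) _) _.
  by rewrite subrr normr0 ltW.
by rewrite ler_wpM2l// clipV_ball.
Qed.

Let K0 : 0 <= K.
Proof. by rewrite addr_ge0// mulr_ge0// ltW. Qed.

(** The first bound makes the Picard operator halve uniform distances, the second keeps its values
    in the ball of radius r; adding 1 keeps the denominators positive. *)
Let eps := Num.min (1 / (2 * (L + 1))) (r / (K + 1)).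

Let eps0 : 0 < eps.
Proof.
by rewrite lt_min !divr_gt0// ?mulr_gt0// ltr_wpDl.
Qed.

Let Leps : L * eps <= 1 / 2.
Proof.
apply: (@le_trans _ _ (L * (1 / (2 * (L + 1))))).
  by rewrite ler_wpM2l// ge_min lexx.
rewrite mul1r invfM mulrCA mul1r ler_piMr// ler_pdivrMr ?ltr_wpDl//.
by rewrite mul1r lerDl.
Qed.

Let Keps : K * eps <= r.
Proof.
apply: (@le_trans _ _ (K * (r / (K + 1)))).
  by rewrite ler_wpM2l// ge_min lexx orbT.
rewrite mulrCA ler_piMr ?(ltW r0)// ler_pdivrMr ?ltr_wpDl//.
by rewrite mul1r lerDl.
Qed.

Let clipT (t : R) := clip eps 0 t.

Let clipT_bounds t s :
  Num.min 0 (clipT t) <= s <= Num.max 0 (clipT t) -> - eps - 1 < s.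
Proof.
have := clip_bounds 0 t (ltW eps0); rewrite subr0 ler_norml => /andP[h1 _].
move=> /andP[h _]; apply: lt_le_trans h.
have e0 := eps0; rewrite lt_min; apply/andP; split; last rewrite /clipT; lra.
Qed.

Let clipT_norm t : `|clipT t| <= eps.
Proof. by have := clip_bounds 0 t (ltW eps0); rewrite subr0. Qed.

(** Continuity of [w] is a premise under the existential, so that [choice] yields an operator
    defined on all curves. *)
Let picard_step (w : R -> 'rV[R]_m) : exists G : R -> 'rV[R]_m,
  continuous w -> G 0 = x0 /\ forall t : R, - eps - 1 < t -> is_derive t 1 G (F (w t)).
Proof.
have [cw|] := pselect (continuous w); last by exists (fun=> 0).
have [|G HG] := @antiderivative_rV R m (F \o w) (- eps - 1).
  move=> t; apply: continuous_comp; first exact: cw.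
  exact: (lipschitz_continuous FL).
exists (fun t => G t - (G 0 - x0)) => _; split; first by rewrite opprB addrC subrK.
move=> t ht; have := is_deriveB (HG t ht) (is_derive_cst (G 0 - x0) t 1).
by rewrite subr0.
Qed.

(* The right-hand side is clipped to the ball and the time to [-eps, eps], so
   that the Picard iterates are defined, and converge uniformly, on all of R. *)
Lemma picard_lindelof : exists (e : R) (u : R -> 'rV[R]_m), [/\ 0 < e, u 0 = x0,
  forall t, `|u t - x0| <= r &
  forall t : R, `|t| < e -> is_derive t 1 u (f (u t))].
Proof.
have [T0 HT0] := choice picard_step.
pose T w t := T0 w (clipT t).
have T_ball w : continuous w -> forall t, `|T w t - x0| <= r.
  move=> cw t; have [G0 dG] := HT0 w cw.
  rewrite -G0; apply: le_trans Keps.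
  apply: (@le_trans _ _ (K * `|clipT t - 0|)).
    apply: (@derive_norm_le _ _ (T0 w) (F \o w) K 0 (clipT t)) => s hs; last exact: FK.
    by apply: dG; exact: clipT_bounds hs.
  by rewrite subr0 ler_wpM2l.
have T_lip w : continuous w -> forall s t, `|T w s - T w t| <= K * `|s - t|.
  move=> cw s t; have [_ dG] := HT0 w cw.
  apply: (@le_trans _ _ (K * `|clipT s - clipT t|)); last first.
    by rewrite ler_wpM2l// clip_lipschitz.
  apply: (@derive_norm_le _ _ (T0 w) (F \o w) K (clipT t) (clipT s)) => x; last by move=> _; exact: FK.
  move=> /andP[+ _] => h; apply: dG; apply: lt_le_trans h.
  have e0 := eps0; have /= := clipT_norm s; have /= := clipT_norm t.
  by rewrite !ler_norml lt_min => /andP[h1 h2] /andP[h3 h4]; apply/andP; split; lra.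
have T_contr w w' D : continuous w -> continuous w' ->
    (forall t, `|w t - w' t| <= D) -> forall t, `|T w t - T w' t| <= D / 2.
  move=> cw cw' HD t; have [G0 dG] := HT0 w cw; have [G0' dG'] := HT0 w' cw'.
  have D0 : 0 <= D by apply: le_trans (HD 0).
  apply: (@le_trans _ _ ((L * D) * `|clipT t - 0|)); last first.
    rewrite subr0 mulrAC -[_ * D]mulrC ler_wpM2l//.
    by apply: le_trans (ler_wpM2l L0 (clipT_norm t)) _; rewrite -[leRHS]mul1r.
  have -> : T w t - T w' t = (T0 w - T0 w') (clipT t) - (T0 w - T0 w') 0.
    by rewrite !fctE /= G0 G0' subrr subr0.
  apply: (@derive_norm_le _ _ (T0 w - T0 w') (fun t => F (w t) - F (w' t)) (L * D) 0 (clipT t)) => s hs.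
    by apply: is_deriveB; [apply: dG|apply: dG']; exact: clipT_bounds hs.
  by apply: le_trans (FL _ _) _; rewrite ler_wpM2l.
pose u_ n := iter n T (fun=> x0).
have cu n : continuous (u_ n).
  elim: n => [|n IH]; first by move=> ?; exact: cvg_cst.
  exact: (lipschitz_continuous (T_lip _ IH)).
have u_step n : forall t, `|u_ n.+1 t - u_ n t| <= r / 2 ^+ n.
  elim: n => [|n IH] t.
    by rewrite expr0 divr1; apply: T_ball; exact: (cu 0%N).
  have -> : r / 2 ^+ n.+1 = r / 2 ^+ n / 2 by rewrite exprSr invfM mulrA.
  exact: (T_contr _ _ _ (cu n.+1) (cu n)).
have Hu t : exists l, forall n, `|l - u_ n t| <= r *+ 2 / 2 ^+ n.
  by apply: geometric_limit_rV => [|n]; [exact: ltW|exact: u_step].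
have [u uE] := choice Hu.
have r2 : 0 <= r *+ 2 by rewrite mulrn_wge0// ltW.
have uL s t : `|u s - u t| <= K * `|s - t|.
  apply: (@le_add_geometric _ _ (r *+ 2)) => // k.
  have -> : u s - u t = (u s - u_ k.+1 s) - (u t - u_ k.+1 t) + (u_ k.+1 s - u_ k.+1 t).
    by apply/rowP => i; rewrite !mxE; ring.
  apply: le_trans (ler_normD _ _) _; rewrite addrC; apply: lerD.
    by apply: T_lip; exact: cu.
  apply: le_trans (ler_normB _ _) _.
  have -> : r *+ 2 / 2 ^+ k = r *+ 2 / 2 ^+ k.+1 + r *+ 2 / 2 ^+ k.+1.
    by rewrite exprSr invfM mulrA -splitr.
  by apply: lerD; exact: uE.
have cu' : continuous u := lipschitz_continuous uL.
(* Passage to the limit in u_{k+1} = T u_k, as T halves the distance between u_k and u. *)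
have uT t : u t = T u t.
  apply/eqP; rewrite -subr_eq0 -normr_le0.
  apply: (@le_add_geometric _ _ (r *+ 2)) => // k; rewrite add0r.
  have -> : u t - T u t = (u t - u_ k.+1 t) - (T u t - T (u_ k) t).
    by rewrite opprB addrA subrK.
  apply: le_trans (ler_normB _ _) _.
  have -> : r *+ 2 / 2 ^+ k = r *+ 2 / 2 ^+ k.+1 + r *+ 2 / 2 ^+ k / 2.
    by rewrite exprSr invfM !mulrA -splitr.
  by apply: lerD; [exact: uE|apply: T_contr].
have [G0 dG] := HT0 u cu'.
have ub t : `|u t - x0| <= r by rewrite uT; exact: T_ball.
exists eps, u; split => //.
  by rewrite uT /T /clipT clip_id ?subrr ?normr0 ?ltW.
move=> t te.
have : is_derive t 1 (T0 u) (f (u t)).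
  have := dG t; rewrite /F clipV_id//; apply.
  by move: te; rewrite ltr_norml => /andP[h _]; lra.
apply: near_eq_is_derive; near=> s.
rewrite (uT s) /T /clipT clip_id// subr0.
by near: s; apply: (@cvgr_norm_le _ _ _ _ _ id t) => //; exact: cvg_id.
Unshelve. all: by end_near. Qed.

End Picard.

(* exp (- C t) |z t|^2 is nonincreasing. *)
Lemma linear_ode_zero (R : realType) m (L : {linear 'rV[R]_m -> 'rV[R]_m})
    (z : R -> 'rV[R]_m) :
  (forall t : R, is_derive t 1 z (L (z t))) -> z 0 = 0 -> forall t, 0 <= t -> z t = 0.
Proof.
move=> dz z0 t t0.
pose K : R := \sum_(i < m) `|L (delta_mx ord0 i)|.
have K0 : 0 <= K by apply: sumr_ge0.
have LK x : `|L x| <= K * `|x|.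
  rewrite linear_rV_sum mulr_suml; apply: le_trans (ler_norm_sum _ _ _) _.
  by apply: ler_sum => i _; rewrite normrZ mulrC ler_wpM2l// rV_coord_le.
pose E (s : R) : R := \sum_(i < m) z s ord0 i ^+ 2.
have E_ge0 s : 0 <= E s by apply: sumr_ge0 => i _; exact: sqr_ge0.
have zE s : `|z s| <= Num.sqrt (E s).
  apply: rV_norm_le => [|i]; first exact: sqrtr_ge0.
  rewrite -sqrtr_sqr ler_wsqrtr// /E (bigD1 i)//= lerDl.
  by apply: sumr_ge0 => j _; exact: sqr_ge0.
have zE2 s : `|z s| ^+ 2 <= E s.
  by rewrite -[leRHS](sqr_sqrtr (E_ge0 s)) ler_pXn2r// nnegrE ?sqrtr_ge0.
(* Each of the m terms of E' is at most 2 K |z|^2, hence at most 2 K E. *)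
pose C : R := (K *+ 2) *+ m.
pose dE s : R := \sum_(i < m) z s ord0 i * L (z s) ord0 i *+ 2.
have E_derive (s : R) : is_derive s 1 E (dE s).
  have -> : E = \sum_(i < m) (fun s => z s ord0 i) ^+ 2.
    by apply/funext => x; rewrite fct_sumE; apply: eq_bigr => i _; rewrite fctE.
  apply: is_derive_sum => i.
  have Hi := (is_derive_rV _ _ _).1 (dz s) i.
  apply: is_derive_eq; rewrite /GRing.scale/=.
  by rewrite expr1 -mulrA mulr_natl.
have dEC s : dE s <= C * E s.
  rewrite /C mulrnAl -[m in leRHS]card_ord -sumr_const; apply: ler_sum => i _.
  rewrite mulrnAl lerMn2r/=; apply: le_trans (ler_norm _) _; rewrite normrM.
  apply: (@le_trans _ _ (`|z s| * (K * `|z s|))).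
    by rewrite ler_pM// ?rV_coord_le// (le_trans (rV_coord_le _ _)).
  by rewrite mulrCA -expr2 ler_wpM2l.
pose f s : R := expR (- C * s) * E s.
pose df s : R := expR (- C * s) * (dE s - C * E s).
have f_derive (s : R) : is_derive s 1 f (df s).
  have H1 : is_derive s 1 (fun s : R => expR (- C * s)) (expR (- C * s) * - C).
    have Hm : is_derive s 1 (fun s : R => - C * s) (- C).
      by apply: is_derive_eq (is_deriveZ (- C) (is_derive_id s 1)) _; rewrite /GRing.scale/= mulr1.
    have He : differentiable (expR : R -> R) (- C * s).
      exact/derivable1_diffP/derivable_expR.
    have := is_derive_diff_comp Hm He.
    by rewrite diff1E// derive1E derive_val /GRing.scale/= mulrC.
  apply: is_derive_eq (is_deriveM H1 (E_derive s)) _.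
  by rewrite /df /GRing.scale/=; ring.
have : f t <= f 0.
  apply: (@ler0_derive1_nincr _ f 0 t); rewrite ?lexx//.
  - move=> x _; rewrite derive1E derive_val; rewrite /df.
    by rewrite mulr_ge0_le0 ?expR_ge0// subr_le0.
  - apply: derivable_within_continuous => x _; by case: (f_derive x).
have E00 : E 0 = 0.
  by apply: big1 => i _; rewrite z0 mxE expr0n.
rewrite /f E00 mulr0 pmulr_rle0 ?expR_gt0// => Et.
have {}Et : E t = 0 by apply: le_anti; rewrite Et E_ge0.
by apply/eqP; rewrite -normr_le0 (le_trans (zE t))// Et sqrtr0.
Qed.

(** * Velocities of curves in a Lie group *)

Section Charts.
Context {R : realType} {d : nat} {M : manifoldType R d}.

Lemma chart_cmapK (c : chart R d M) u : (cmap c @` cdom c) u ->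
  cdom c (cinv c u) /\ cmap c (cinv c u) = u.
Proof. by move=> [x cx <-]; rewrite cmapK. Qed.

Lemma near_chart (c : chart R d M) x (A : set M) : cdom c x -> nbhs x A ->
  \forall u \near cmap c x, [/\ cdom c (cinv c u), cmap c (cinv c u) = u & A (cinv c u)].
Proof.
move=> cx xA.
have ox : (cmap c @` cdom c) (cmap c x) by exists x.
have h1 : \forall u \near cmap c x, (cmap c @` cdom c) u.
  by apply: open_nbhs_nbhs; split => //; exact: cimg_open.
have h2 : \forall u \near cmap c x, A (cinv c u).
  by apply: (cinv_continuous ox); rewrite cmapK.
by near=> u; have [] : cdom c (cinv c u) /\ cmap c (cinv c u) = u;
  [apply: chart_cmapK; near: u|split => //; near: u].
Unshelve. all: by end_near. Qed.

Lemma near_cdom (c : chart R d M) x : cdom c x -> \forall y \near x, cdom c y.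
Proof. by move=> cx; apply: open_nbhs_nbhs; split => //; exact: cdom_open. Qed.

Lemma transition_differentiable (c c' : chart R d M) x : atlas c -> atlas c' ->
  cdom c x -> cdom c' x -> differentiable (cmap c' \o cinv c) (cmap c x).
Proof.
move=> ac ac' cx c'x; have [+ _] := transition_smooth _ _ ac ac' 1%N.
by apply; exists x.
Qed.

End Charts.

Section Velocity.
Context {R : realType} {d : nat} {G : lieGroupType R d}.
Implicit Types (g h : G) (c : R -> G) (v w : 'rV[R]_d) (t : R).

Local Notation phi g := (cmap (chart_at (g : G))).
Local Notation psi g := (cinv (chart_at (g : G))).

Lemma chart_atK g : psi g (phi g g) = g.
Proof. by rewrite cmapK//; exact: chart_at_dom. Qed.

(** The tool for computing tangent maps: two expressions for the velocity of the same curve at the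
    same time must agree. *)
Lemma has_velocity_uniq c t v w : has_velocity c t v -> has_velocity c t w -> v = w.
Proof. by move=> [_ [_ <-]] [_ [_ <-]]. Qed.

Lemma has_velocity_chart c t v (k : chart R d G) : has_velocity c t v -> atlas k ->
  cdom k (c t) ->
  is_derive t 1 (cmap k \o c) ('d (cmap k \o psi (c t)) (phi (c t) (c t)) v).
Proof.
move=> [cc dc] ak kc.
have dT := transition_differentiable (chart_at_atlas (c t)) ak (chart_at_dom (c t)) kc.
have := is_derive_diff_comp dc dT.
apply: near_eq_is_derive; near=> s => /=; rewrite cmapK//.
by near: s; apply: cc; apply: near_cdom; exact: chart_at_dom.
Unshelve. all: by end_near. Qed.

Lemma chart_has_velocity c t w (k : chart R d G) : {for t, continuous c} -> atlas k ->
  cdom k (c t) -> is_derive t 1 (cmap k \o c) w ->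
  has_velocity c t ('d (phi (c t) \o cinv k) (cmap k (c t)) w).
Proof.
move=> cc ak kc dc; split => //.
have dT := transition_differentiable ak (chart_at_atlas (c t)) kc (chart_at_dom (c t)).
have := is_derive_diff_comp dc dT.
apply: near_eq_is_derive; near=> s => /=; rewrite cmapK//.
by near: s; apply: cc; exact: near_cdom.
Unshelve. all: by end_near. Qed.

(** A pointwise notion in the preferred charts, which is all the chain rule for velocities requires;
    translations satisfy it by freezing one argument of the product. *)
Definition mfd_differentiable (f : G -> G) g := {for g, continuous f} /\
  differentiable (phi (f g) \o f \o psi g) (phi g g).

Lemma smooth_map_mfd_differentiable (f : G -> G) g : smooth_map f -> mfd_differentiable f g.
Proof.
move=> [cf sf]; split; first exact: cf.
have [+ _] := sf _ _ (chart_at_atlas g) (chart_at_atlas (f g)) 1%N.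
by apply; exists g => //; split; exact: chart_at_dom.
Qed.

Lemma has_velocity_comp (f : G -> G) c t v : mfd_differentiable f (c t) -> has_velocity c t v ->
  has_velocity (f \o c) t (tangent_map f (c t) v).
Proof.
move=> [cf df] [cc dc]; split; first exact: continuous_comp.
have := is_derive_diff_comp dc df.
apply: near_eq_is_derive; near=> s => /=; rewrite cmapK//.
by near: s; apply: cc; apply: near_cdom; exact: chart_at_dom.
Unshelve. all: by end_near. Qed.

Lemma near_has_velocity c c' t v : (\near t, c t = c' t) -> has_velocity c t v ->
  has_velocity c' t v.
Proof.
move=> cc' [cc dc]; have ct := nbhs_singleton cc'; split.
  have : c' @ t --> c t by apply: cvg_trans cc; exact: near_eq_cvg.
  by rewrite ct.
rewrite -ct; apply: near_eq_is_derive dc; near=> s => /=; congr (cmap _ _).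
by near: s.
Unshelve. all: by end_near. Qed.

(** A straight line in the chart at g. It provides a test curve for each tangent vector. *)
Lemma has_velocity_exists g v : exists2 c, c 0 = g & has_velocity c 0 v.
Proof.
pose c (t : R) := psi g (t *: v + phi g g).
have c0 : c 0 = g by rewrite /c scale0r add0r chart_atK.
exists c => //; split.
  apply: continuous_comp.
    by apply/differentiable_continuous/derivable1_diffP; have [] := is_derive_affine v (phi g g) 0.
  rewrite scale0r add0r; apply: cinv_continuous.
  by exists g => //; exact: chart_at_dom.
have H : \forall u \near phi g g, phi g (psi g u) = u.
  by apply: filterS (near_chart (chart_at_dom g) filterT) => u [].
have cu : (fun s : R => s *: v + phi g g) @ (0 : R) --> phi g g.
  have : {for 0, continuous (fun s : R => s *: v + phi g g)}.
    by apply/differentiable_continuous/derivable1_diffP; have [] := is_derive_affine v (phi g g) 0.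
  by rewrite /prop_for /continuous_at scale0r add0r.
rewrite c0; apply: near_eq_is_derive (is_derive_affine v (phi g g) 0).
near=> s => /=; rewrite /c.
by apply/esym; near: s; exact: (cu _ H).
Unshelve. all: by end_near. Qed.

Lemma has_velocity_cst g t : has_velocity (fun=> g) t 0.
Proof. by split; [exact: cvg_cst|exact: is_derive_cst]. Qed.

Let mul_chart g h (u : 'rV[R]_d * 'rV[R]_d) := phi (g * h)%g (psi g u.1 * psi h u.2)%g.

Lemma mul_chart_differentiable g h : differentiable (mul_chart g h) (phi g g, phi h h).
Proof.
have [_ /(_ _ _ _ (chart_at_atlas g) (chart_at_atlas h) (chart_at_atlas (g * h)%g) 1%N)] :=
  @mulg_smooth R d G.
case=> + _; apply; exists (g, h) => //; split; exact: chart_at_dom.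
Qed.

Lemma mulg_continuous2 : continuous (fun z : G * G => (z.1 * z.2)%g).
Proof. by have [] := @mulg_smooth R d G. Qed.

Lemma continuous_mulg (T : topologicalType) (a b : T -> G) (x : T) :
  {for x, continuous a} -> {for x, continuous b} ->
  {for x, continuous (fun y => a y * b y)%g}.
Proof.
move=> ca cb.
apply: (@continuous_comp _ _ _ (fun y => (a y, b y)) (fun z : G * G => (z.1 * z.2)%g)).
  exact: cvg_pair.
exact: mulg_continuous2.
Qed.

Lemma has_velocity_mul_chart (a b : R -> G) t v w : has_velocity a t v -> has_velocity b t w ->
  has_velocity (fun s => a s * b s)%g t
    ('d (mul_chart (a t) (b t)) (phi (a t) (a t), phi (b t) (b t)) (v, w)).
Proof.
move=> [ca da] [cb db]; split.
  exact: continuous_mulg.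
have := is_derive_diff_comp (is_derive_pair da db) (mul_chart_differentiable _ _).
apply: near_eq_is_derive; near=> s => /=; rewrite /mul_chart/= !cmapK//.
  by near: s; apply: cb; apply: near_cdom; exact: chart_at_dom.
by near: s; apply: ca; apply: near_cdom; exact: chart_at_dom.
Unshelve. all: by end_near. Qed.

Lemma mfd_differentiable_mull g h : mfd_differentiable (fun x => g * x)%g h.
Proof.
split.
  by apply: continuous_mulg; [exact: cvg_cst|exact: cvg_id].
have -> : phi (g * h)%g \o (fun x => g * x)%g \o psi h =
    mul_chart g h \o (fun u => (phi g g, u)).
  by apply/funext => u; rewrite /mul_chart/= chart_atK.
apply: differentiable_comp; last exact: mul_chart_differentiable.
by apply: differentiable_pair; [exact: differentiable_cst|].
Qed.

Lemma mfd_differentiable_mulr g h : mfd_differentiable (fun x => x * g)%g h.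
Proof.
split.
  by apply: continuous_mulg; [exact: cvg_id|exact: cvg_cst].
have -> : phi (h * g)%g \o (fun x => x * g)%g \o psi h =
    mul_chart h g \o (fun u => (u, phi g g)).
  by apply/funext => u; rewrite /mul_chart/= chart_atK.
apply: differentiable_comp; last exact: mul_chart_differentiable.
by apply: differentiable_pair; [|exact: differentiable_cst].
Qed.

(** The differential of the product at (v, w) splits as (v, 0) + (0, w), and each half is the
    velocity of a product with one factor frozen. *)
Lemma has_velocity_mul (a b : R -> G) t v w : has_velocity a t v -> has_velocity b t w ->
  has_velocity (fun s => a s * b s)%g t
    (tangent_map (fun x : G => x * b t)%g (a t) v + tangent_map (fun x : G => a t * x)%g (b t) w).
Proof.
move=> Ha Hb.
have -> : tangent_map (fun x => x * b t)%g (a t) v =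
    'd (mul_chart (a t) (b t)) (phi (a t) (a t), phi (b t) (b t)) (v, 0).
  apply: (@has_velocity_uniq (fun s => a s * b t)%g t).
    exact: has_velocity_comp (mfd_differentiable_mulr _ _) Ha.
  exact: has_velocity_mul_chart Ha (has_velocity_cst _ _).
have -> : tangent_map (fun x => a t * x)%g (b t) w =
    'd (mul_chart (a t) (b t)) (phi (a t) (a t), phi (b t) (b t)) (0, w).
  apply: (@has_velocity_uniq (fun s => a t * b s)%g t).
    exact: has_velocity_comp (mfd_differentiable_mull _ _) Hb.
  exact: has_velocity_mul_chart (has_velocity_cst _ _) Hb.
rewrite -linearD/=.
have -> : ((v, 0) + (0, w) : 'rV[R]_d * 'rV[R]_d) = (v, w).
  by congr (_, _) => /=; rewrite ?addr0 ?add0r.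
exact: has_velocity_mul_chart.
Qed.

End Velocity.

(** * Left translations, left velocities and the adjoint representation *)

Section Translations.
Context {R : realType} {d : nat} {G : lieGroupType R d}.
Implicit Types (g h : G) (c a b : R -> G) (v w : 'rV[R]_d) (t : R).

(* The indicator function of [c t = c 0] is locally constant, hence constant by
   the mean value theorem. *)
Lemma velocity0_cst c (e : R) : (forall t, `|t| < e -> has_velocity c t 0) ->
  forall t, `|t| < e -> c t = c 0.
Proof.
move=> H.
have loc t : `|t| < e -> \forall s \near t, c s = c t.
  move=> te; pose k := chart_at (c t).
  have : \forall s \near t, `|s| < e /\ cdom k (c s).
    near=> s; split.
      by near: s; apply: (@cvgr_norm_lt _ _ _ _ _ id t) => //; exact: cvg_id.
    by near: s; apply: (H t te).1; apply: near_cdom; exact: chart_at_dom.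
  move=> /nbhs_ballP[r /= r0 Hr].
  apply/nbhs_ballP; exists r => //= s sr.
  have ks := (Hr s sr).2.
  have kt : cdom k (c t) by apply: chart_at_dom.
  rewrite -(cmapK ks) -(cmapK kt); congr (cinv k _).
  apply: (@derive0_cst _ _ (cmap k \o c)) => x xts.
  have [xe kx] : `|x| < e /\ cdom k (c x).
    apply: Hr; move: sr; rewrite -!ball_normE/= !ltr_norml => /andP[s1 s2].
    by move: xts => /andP[+ +]; rewrite ge_min le_max => /orP[] x1 /orP[] x2;
      apply/andP; split; lra.
  by have := has_velocity_chart (H x xe) (chart_at_atlas _) kx; rewrite linear0.
move=> t te.
pose f s : 'rV[R]_1 := const_mx (if pselect (c s = c 0) then 0 else 1).
have : f t = f 0.
  apply: derive0_cst => x xt.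
  have xe : `|x| < e.
    move: te; rewrite !ltr_norml => /andP[h1 h2].
    by move: xt => /andP[+ +]; rewrite ge_min le_max => /orP[] x1 /orP[] x2;
      apply/andP; split; lra.
  apply: near_eq_is_derive (is_derive_cst (f x) x 1).
  by apply: filterS (loc x xe) => s cs; rewrite /f /= cs.
rewrite /f; case: pselect => //= ct; case: pselect => //= _.
by move=> /rowP/(_ ord0); rewrite !mxE => /eqP; rewrite oner_eq0.
Unshelve. all: by end_near. Qed.

Lemma has_velocity_affine c t v (p q : R) : has_velocity c (p * t + q) v ->
  has_velocity (fun s => c (p * s + q)) t (p *: v).
Proof.
move=> [cc dc].
have dp : is_derive t 1 (fun s : R => p * s + q) p.
  have H := is_deriveD (is_deriveZ p (is_derive_id t 1)) (is_derive_cst q t 1).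
  by apply: is_derive_eq H _; rewrite /GRing.scale/= addr0 mulr1.
split.
  apply: (@continuous_comp _ _ _ (fun s : R => p * s + q) c) => //.
  by apply/differentiable_continuous/derivable1_diffP; case: dp.
have df := (derivable1_diffP _ _).1 (ex_derive (is_derive := dc)).
have := is_derive_diff_comp dp df.
by rewrite diff1E// derive1E derive_val.
Qed.

Lemma dL_velocity c t v g : has_velocity c t v -> c t = 1%g ->
  has_velocity (fun s => g * c s)%g t (dL g v).
Proof. by move=> H c1; have := has_velocity_comp (mfd_differentiable_mull g (c t)) H; rewrite c1. Qed.

Lemma dL1 v : dL (1%g : G) v = v.
Proof.
have [c c0 cv] := has_velocity_exists (1%g : G) v.
apply: (has_velocity_uniq (c := c) (t := 0)) => //.
by have := dL_velocity 1%g cv c0; under eq_fun do rewrite mul1g.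
Qed.

(** The tangent map at g of the translation by g^-1 is a left inverse, as a test curve shows. *)
Lemma dL_inj g : injective (@dL R d G g).
Proof.
move=> v w vw.
have E u : u = tangent_map (fun x => g^-1 * x)%g g (dL g u).
  have [c c0 cu] := has_velocity_exists (1%g : G) u.
  apply: (has_velocity_uniq (c := c) (t := 0)) => //.
  have := dL_velocity g cu c0.
  have gE : (g * c 0)%g = g by rewrite c0 mulg1.
  move=> /(has_velocity_comp (mfd_differentiable_mull g^-1%g (g * c 0)%g)); rewrite gE.
  have -> // : (fun x => g^-1 * x)%g \o (fun s => g * c s)%g = c.
  by apply/funext => s /=; rewrite mulKg.
by rewrite (E v) vw -E.
Qed.

(** The left logarithmic (Darboux) derivative c^-1 c', which brings velocities at all points into
    one vector space. *)
Definition left_velocity c t v := has_velocity c t (dL (c t) v).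

Lemma left_velocity_uniq c t v w : left_velocity c t v -> left_velocity c t w -> v = w.
Proof. by move=> cv cw; apply: (@dL_inj (c t)); exact: has_velocity_uniq cv cw. Qed.

Lemma left_velocity_exists c t w : has_velocity c t w -> exists v, left_velocity c t v.
Proof.
move=> cw; have cw' := has_velocity_comp (mfd_differentiable_mull (c t)^-1%g (c t)) cw.
eexists; rewrite /left_velocity.
have /= := dL_velocity (c t) cw' (mulVg _).
by under eq_fun do rewrite mulVKg; exact.
Qed.

Lemma tangent_dL g h v : tangent_map (fun x => g * x)%g h (dL h v) = dL (g * h)%g v.
Proof.
have [c c0 cv] := has_velocity_exists (1%g : G) v.
have hE : (h * c 0)%g = h by rewrite c0 mulg1.
apply: (has_velocity_uniq (c := fun s => (g * (h * c s))%g) (t := 0)).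
  have := has_velocity_comp (mfd_differentiable_mull g (h * c 0)%g) (dL_velocity h cv c0).
  by rewrite hE.
by have := dL_velocity (g * h)%g cv c0; under eq_fun do rewrite -mulgA.
Qed.

Lemma left_velocity_mull g c t v : left_velocity c t v ->
  left_velocity (fun s => g * c s)%g t v.
Proof.
move=> H; have := has_velocity_comp (mfd_differentiable_mull g (c t)) H.
by rewrite tangent_dL.
Qed.

Lemma left_velocity1 c t v : c t = 1%g -> left_velocity c t v <-> has_velocity c t v.
Proof. by move=> c1; rewrite /left_velocity c1 dL1. Qed.

Lemma mfd_differentiable_comp (f f' : G -> G) g : mfd_differentiable f g ->
  mfd_differentiable f' (f g) -> mfd_differentiable (f' \o f) g.
Proof.
move=> [cf df] [cf' df']; split; first exact: continuous_comp.
have := differentiable_comp df; rewrite /= chart_atK => /(_ _ _ df').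
apply: near_eq_differentiable.
have H : \forall x \near g, cdom (chart_at (f g)) (f x).
  by apply: cf; apply: near_cdom; exact: chart_at_dom.
by apply: filterS (near_chart (chart_at_dom g) H) => u [_ _] /= /cmapK ->.
Qed.

Lemma mfd_differentiable_conj g h : mfd_differentiable (fun x => g * x * g^-1)%g h.
Proof.
exact: (mfd_differentiable_comp (mfd_differentiable_mull g h)
  (mfd_differentiable_mulr g^-1%g _)).
Qed.

(** [Ad g] with its linear structure. The target chart is taken at g * 1 * g^-1 rather than at 1, so
    that the two are convertible. *)
Definition Ad_lin g : {linear 'rV[R]_d -> 'rV[R]_d} :=
  'd (cmap (chart_at (g * 1 * g^-1)%g) \o (fun h => g * h * g^-1)%g
      \o cinv (chart_at (1%g : G))) (cmap (chart_at (1%g : G)) 1%g).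

Lemma AdE g : Ad g = Ad_lin g :> (_ -> _). Proof. by []. Qed.

Lemma AdD g v w : Ad g (v + w) = Ad g v + Ad g w.
Proof. by rewrite AdE linearD. Qed.

Lemma AdZ g x v : Ad g (x *: v) = x *: Ad g v.
Proof. by rewrite AdE linearZ. Qed.

Lemma conj_velocity g c t v : has_velocity c t v -> c t = 1%g ->
  has_velocity (fun s => g * c s * g^-1)%g t (Ad g v).
Proof. by move=> H c1; have := has_velocity_comp (mfd_differentiable_conj g (c t)) H; rewrite c1. Qed.

Lemma Ad1 v : Ad (1%g : G) v = v.
Proof.
have [c c0 cv] := has_velocity_exists (1%g : G) v.
apply: (has_velocity_uniq (c := c) (t := 0)) => //.
have := conj_velocity 1%g cv c0.
by under eq_fun do rewrite invg1 mulg1 mul1g.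
Qed.

Lemma AdM g h v : Ad (g * h)%g v = Ad g (Ad h v).
Proof.
have [c c0 cv] := has_velocity_exists (1%g : G) v.
apply: (has_velocity_uniq (c := fun s => (g * h * c s * (g * h)^-1)%g) (t := 0)).
  exact: conj_velocity.
have h1 : (h * c 0 * h^-1)%g = 1%g by rewrite c0 mulg1 mulgV.
have := conj_velocity g (conj_velocity h cv c0) h1.
have -> // : (fun s => g * (h * c s * h^-1) * g^-1)%g =
    (fun s => g * h * c s * (g * h)^-1)%g.
by apply/funext => s; rewrite invgM !mulgA.
Qed.

Lemma AdK g : cancel (Ad g) (Ad g^-1%g).
Proof. by move=> v; rewrite -AdM mulVg Ad1. Qed.

Lemma AdVK g : cancel (Ad g^-1%g) (Ad g).
Proof. by move=> v; rewrite -AdM mulgV Ad1. Qed.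

(** With c a test curve for v through 1, a c b = (a b) (b^-1 c b): moving b to the left of the first
    velocity costs Ad b^-1. *)
Lemma left_velocity_mul a b t v w : left_velocity a t v -> left_velocity b t w ->
  left_velocity (fun s => a s * b s)%g t (Ad (b t)^-1%g v + w).
Proof.
move=> av bw; have := has_velocity_mul av bw.
rewrite tangent_dL /left_velocity.
have -> : tangent_map (fun x => x * b t)%g (a t) (dL (a t) v) =
    dL (a t * b t)%g (Ad (b t)^-1%g v).
  have [c c0 cv] := has_velocity_exists (1%g : G) v.
  have aE : (a t * c 0)%g = a t by rewrite c0 mulg1.
  apply: (has_velocity_uniq (c := fun s => (a t * c s * b t)%g) (t := 0)).
    have := has_velocity_comp (mfd_differentiable_mulr (b t) (a t * c 0)%g) (dL_velocity (a t) cv c0).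
    by rewrite aE.
  have c1 : ((b t)^-1 * c 0 * (b t)^-1^-1)%g = 1%g by rewrite c0 mulg1 mulgV.
  have := dL_velocity (a t * b t)%g (conj_velocity (b t)^-1%g cv c0) c1.
  by under eq_fun do rewrite invgK !mulgA mulgK.
by rewrite /dL /tangent_map linearD.
Qed.

Lemma dL0 g : dL g 0 = 0. Proof. by rewrite /dL /tangent_map linear0. Qed.

Lemma left_velocity_cst g t : left_velocity (fun=> g) t 0.
Proof. by rewrite /left_velocity dL0; exact: has_velocity_cst. Qed.

(** Smoothness of the inverse gives some left velocity w for c^-1; since c c^-1 is constant, the
    product rule forces Ad (c t) v + w = 0. *)
Lemma left_velocity_inv c t v : left_velocity c t v ->
  left_velocity (fun s => (c s)^-1)%g t (- Ad (c t) v).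
Proof.
move=> cv.
have := has_velocity_comp (smooth_map_mfd_differentiable _ (@invg_smooth R d G)) cv.
move=> /left_velocity_exists[w cw].
suff -> : - Ad (c t) v = w by [].
apply/esym/eqP; rewrite -addr_eq0 addrC; apply/eqP.
apply: (@left_velocity_uniq (fun=> 1%g) t); last exact: left_velocity_cst.
have := left_velocity_mul cv cw; rewrite /= invgK.
by under eq_fun do rewrite mulgV.
Qed.

(** Stated on a symmetric interval because it also serves for the local flow, which exists only for
    small times. *)
Lemma left_velocity_eq a b (om : R -> 'rV[R]_d) (e : R) : a 0 = b 0 ->
  (forall t, `|t| < e -> left_velocity a t (om t)) ->
  (forall t, `|t| < e -> left_velocity b t (om t)) ->
  forall t, `|t| < e -> a t = b t.
Proof.
move=> ab0 Ha Hb t te; apply/eqP; rewrite -divg_eq1; apply/eqP.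
have /= := @velocity0_cst (fun s => a s * (b s)^-1)%g e _ t te.
rewrite ab0 mulgV; apply => s se.
have := left_velocity_mul (Ha s se) (left_velocity_inv (Hb s se)).
by rewrite invgK subrr /left_velocity dL0.
Qed.

End Translations.

(** * The Lie bracket as the derivative of the adjoint action *)

Section Bracket.
Context {R : realType} {d : nat} {G : lieGroupType R d}.
Implicit Types (g h : G) (c a b : R -> G) (v w : 'rV[R]_d) (t : R).

Local Notation k1 := (chart_at (1%g : G)).
Local Notation phi := (cmap k1).
Local Notation psi := (cinv k1).
Local Notation e := (phi 1%g).

Definition chart_mul (u : 'rV[R]_d * 'rV[R]_d) := phi (psi u.1 * psi u.2)%g.
Definition chart_inv (u : 'rV[R]_d) := phi (psi u)^-1%g.

Definition chart_mul_dom := (fun z : G * G => (phi z.1, phi z.2)) @`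
  [set z | [/\ cdom k1 z.1, cdom k1 z.2 & cdom k1 (z.1 * z.2)%g]].

Lemma chart_mul_smooth : smooth_on chart_mul_dom chart_mul.
Proof.
have [_] := @mulg_smooth R d G.
by apply; exact: chart_at_atlas.
Qed.

Lemma cdom1 : cdom k1 1%g. Proof. exact: chart_at_dom. Qed.

Lemma chart_mul_domP g h : cdom k1 g -> cdom k1 h -> cdom k1 (g * h)%g ->
  chart_mul_dom (phi g, phi h).
Proof. by exists (g, h). Qed.

Lemma chart_mul_differentiable u : chart_mul_dom u -> differentiable chart_mul u.
Proof. by move=> Hu; have [+ _] := chart_mul_smooth 1%N; exact. Qed.

Lemma derive_chart_mul_differentiable (v u : 'rV[R]_d * 'rV[R]_d) :
  chart_mul_dom u -> differentiable ('D_v chart_mul) u.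
Proof. by move=> Hu; have [_ /(_ v)[+ _]] := chart_mul_smooth 2%N; exact. Qed.

Lemma derive2_chart_mul_continuous (v v' u : 'rV[R]_d * 'rV[R]_d) : chart_mul_dom u ->
  {for u, continuous ('D_v' ('D_v chart_mul))}.
Proof. by move=> Hu; exact: (((chart_mul_smooth 2%N).2 v).2 v' _ Hu). Qed.

Lemma chart_inv_differentiable g : cdom k1 g -> cdom k1 g^-1%g ->
  differentiable chart_inv (phi g).
Proof.
move=> kg kg'; have [_] := @invg_smooth R d G.
move=> /(_ _ _ (chart_at_atlas 1%g) (chart_at_atlas 1%g) 1%N)[+ _].
by apply; exists g.
Qed.

Lemma chart_mul_is_derive a b t v w : {for t, continuous a} -> {for t, continuous b} ->
  cdom k1 (a t) -> cdom k1 (b t) -> cdom k1 (a t * b t)%g ->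
  is_derive t 1 (phi \o a) v -> is_derive t 1 (phi \o b) w ->
  is_derive t 1 (fun s => phi (a s * b s)%g) ('d chart_mul (phi (a t), phi (b t)) (v, w)).
Proof.
move=> ca cb ka kb kab da db.
have dm := chart_mul_differentiable (chart_mul_domP ka kb kab).
have := is_derive_diff_comp (is_derive_pair da db) dm.
apply: near_eq_is_derive; near=> s => /=; rewrite /chart_mul/= !cmapK//.
  by near: s; apply: cb; exact: near_cdom.
by near: s; apply: ca; exact: near_cdom.
Unshelve. all: by end_near. Qed.

Lemma velocity1_is_derive c t v : has_velocity c t v -> c t = 1%g ->
  is_derive t 1 (phi \o c) v.
Proof. by move=> [_ dc] c1; rewrite -c1. Qed.

(* Ad g is the tangent map of the left translation by g followed by that of the
   right translation by g^-1; only first derivatives of the multiplication are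
   involved, so that Ad is differentiable in g. *)
Lemma Ad_coord g w : cdom k1 g -> cdom k1 g^-1%g ->
  Ad g w = 'D_('D_(0, w) chart_mul (phi g, e), 0) chart_mul (phi g, phi g^-1%g).
Proof.
move=> kg kg'.
have [a a0 av] := has_velocity_exists (1%g : G) w.
have d1 := velocity1_is_derive av a0.
have c1 : (g * a 0 * g^-1)%g = 1%g by rewrite a0 mulg1 mulgV.
have d2 := velocity1_is_derive (conj_velocity g av a0) c1.
have ca : {for 0, continuous a} by case: av.
have cg (g' : G) : {for (0 : R), continuous (fun=> g')} by exact: cvg_cst.
have kga : cdom k1 (g * a 0)%g by rewrite a0 mulg1.
have ka : cdom k1 (a 0) by rewrite a0; exact: cdom1.
have d3 := chart_mul_is_derive (cg g) ca kg ka kga (is_derive_cst _ _ _) d1.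
have cga : {for (0 : R), continuous (fun s => g * a s)%g} by exact: continuous_mulg.
have kgag : cdom k1 (g * a 0 * g^-1)%g by rewrite c1; exact: cdom1.
have d4 := chart_mul_is_derive cga (cg g^-1%g) kga kg' kgag d3 (is_derive_cst _ _ _).
have <- := @derive_val _ _ _ _ _ _ _ d2.
rewrite [LHS](@derive_val _ _ _ _ _ _ _ d4) /= a0 mulg1.
have mg1 : chart_mul_dom (phi g, e) by apply: chart_mul_domP; rewrite ?mulg1//; exact: cdom1.
have mgV : chart_mul_dom (phi g, phi g^-1%g).
  by apply: chart_mul_domP; rewrite ?mulgV//; exact: cdom1.
by rewrite (deriveE _ (chart_mul_differentiable mgV)) (deriveE _ (chart_mul_differentiable mg1)).
Qed.

Lemma near_chart_inv : \forall u \near e, [/\ cdom k1 (psi u), phi (psi u) = u &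
  cdom k1 (psi u)^-1%g].
Proof.
apply: (near_chart (A := fun x => cdom k1 x^-1%g) cdom1).
have [ci _] := @invg_smooth R d G.
by apply: ci; rewrite invg1; apply: near_cdom; exact: cdom1.
Qed.

Lemma psi_e : psi e = 1%g. Proof. exact/cmapK/cdom1. Qed.

Lemma Ad_differentiable w : differentiable (fun u => Ad (psi u) w) e.
Proof.
have m1 : chart_mul_dom (e, e).
  by apply: chart_mul_domP; rewrite ?mulg1; exact: cdom1.
pose F u := 'D_(0, w) chart_mul (u, e).
(* The direction of the outer derivative moves with u; expanding it in the standard basis leaves
   only derivatives in fixed directions, which are differentiable in the base point. *)
pose f := fun u => \sum_(i < d) F u ord0 i *: 'D_(delta_mx ord0 i, 0) chart_mul (u, chart_inv u).
have ei : chart_inv e = e by rewrite /chart_inv psi_e invg1.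
have dF : differentiable F e.
  apply: (@differentiable_comp _ _ _ _ (fun u => (u, e)) ('D_(0, w) chart_mul)).
    by apply: differentiable_pair => //; exact: differentiable_cst.
  exact: derive_chart_mul_differentiable.
have di : differentiable chart_inv e.
  by apply: chart_inv_differentiable; rewrite ?invg1; exact: cdom1.
apply: (@near_eq_differentiable _ _ _ f).
  near=> u.
  have [ku uE ku'] : [/\ cdom k1 (psi u), phi (psi u) = u & cdom k1 (psi u)^-1%g].
    by near: u; exact: near_chart_inv.
  rewrite Ad_coord// uE /f /F /chart_inv.
  have mu : chart_mul_dom (u, phi (psi u)^-1%g).
    rewrite -{1}uE; apply: chart_mul_domP => //; rewrite mulgV; exact: cdom1.
  have dm := chart_mul_differentiable mu.
  under eq_bigr do rewrite (deriveE _ dm).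
  rewrite (deriveE _ dm); set x := 'D_(0, w) chart_mul (u, e).
  have -> : ((x, 0) : 'rV[R]_d * 'rV[R]_d) =
      \sum_(i < d) x ord0 i *: (delta_mx ord0 i, 0).
    rewrite {1}(row_sum_delta x).
    elim/big_ind2 : _ => [//|_ y1 _ y2 <- <-|i _]; congr (_, _); rewrite /= ?addr0 ?scaler0//.
  by rewrite linear_sum; apply: eq_bigr => i _; rewrite linearZ.
have -> : f = \sum_(i < d) (fun u => F u ord0 i *: 'D_(delta_mx ord0 i, 0) chart_mul (u, chart_inv u)).
  by apply/funext => u; rewrite fct_sumE.
apply: differentiable_sum => i; apply: differentiable_scale.
  exact: (differentiable_comp dF (differentiable_coord _ _ _)).
apply: (@differentiable_comp _ _ _ _ (fun u => (u, chart_inv u)) ('D_(delta_mx ord0 i, 0) chart_mul)).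
  exact: differentiable_pair.
by rewrite ei; exact: derive_chart_mul_differentiable.
Unshelve. all: by end_near. Qed.

Lemma Ad_is_derive_at1 c t v w : has_velocity c t v -> c t = 1%g ->
  is_derive t 1 (fun s => Ad (c s) w) (lie_bracket G v w).
Proof.
move=> cv c1; have dc := velocity1_is_derive cv c1.
have dA : differentiable (fun u => Ad (psi u) w) ((phi \o c) t).
  by rewrite /= c1; exact: Ad_differentiable.
have := is_derive_diff_comp dc dA; rewrite /= c1.
apply: near_eq_is_derive; near=> s => /=; rewrite cmapK//.
by near: s; apply: cv.1; rewrite c1; apply: near_cdom; exact: cdom1.
Unshelve. all: by end_near. Qed.

(** The bracket is a differential in its first argument only; additivity in the second comes from
    that of Ad, differentiated along a curve with velocity v. *)
Lemma lie_bracketDr v w w' : lie_bracket G v (w + w') = lie_bracket G v w + lie_bracket G v w'.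
Proof.
have [c c0 cv] := has_velocity_exists (1%g : G) v.
apply: (is_derive_uniq (Ad_is_derive_at1 (w + w') cv c0)
  (is_deriveD (Ad_is_derive_at1 w cv c0) (Ad_is_derive_at1 w' cv c0))) => s.
by rewrite fctE AdE linearD.
Qed.

Lemma lie_bracketZr v w (x : R) : lie_bracket G v (x *: w) = x *: lie_bracket G v w.
Proof.
have [c c0 cv] := has_velocity_exists (1%g : G) v.
apply: (is_derive_uniq (Ad_is_derive_at1 (x *: w) cv c0)
  (is_deriveZ x (Ad_is_derive_at1 w cv c0))) => s.
by rewrite AdE linearZ.
Qed.

Lemma lie_bracketDl v v' w : lie_bracket G (v + v') w = lie_bracket G v w + lie_bracket G v' w.
Proof. exact: linearD. Qed.

Lemma lie_bracketZl v w (x : R) : lie_bracket G (x *: v) w = x *: lie_bracket G v w.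
Proof. exact: linearZ. Qed.

Lemma lie_bracket0r v : lie_bracket G v 0 = 0.
Proof. by have := lie_bracketZr v 0 0; rewrite !scale0r. Qed.

Lemma lie_bracket0l w : lie_bracket G 0 w = 0.
Proof. exact: linear0. Qed.

Lemma lie_bracket_sumr v I (r : seq I) (P : pred I) (F : I -> 'rV[R]_d) :
  lie_bracket G v (\sum_(i <- r | P i) F i) = \sum_(i <- r | P i) lie_bracket G v (F i).
Proof. exact: (big_morph _ (lie_bracketDr v) (lie_bracket0r v)). Qed.

(** Since Ad (c s) = Ad (c t) Ad ((c t)^-1 c s), the derivative at time t reduces to that along a
    curve through 1. *)
Lemma Ad_is_derive_cst c t v w : left_velocity c t v ->
  is_derive t 1 (fun s => Ad (c s) w) (Ad (c t) (lie_bracket G v w)).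
Proof.
move=> cv.
have c1 : ((c t)^-1 * c t)%g = 1%g by rewrite mulVg.
have cv' := (left_velocity1 v c1).1 (left_velocity_mull (c t)^-1%g cv).
have := is_derive_linear (Ad_lin (c t)) (Ad_is_derive_at1 w cv' c1).
have -> // : Ad_lin (c t) \o (fun s => Ad ((c t)^-1 * c s)%g w) = (fun s => Ad (c s) w).
by apply/funext => s /=; rewrite -AdE -AdM mulVKg.
Qed.

Lemma Ad_is_derive c t v (w : R -> 'rV[R]_d) dw : left_velocity c t v ->
  is_derive t 1 w dw ->
  is_derive t 1 (fun s => Ad (c s) (w s)) (Ad (c t) (lie_bracket G v (w t) + dw)).
Proof.
move=> cv Hw.
have -> : (fun s => Ad (c s) (w s)) =
    (fun s => \sum_(i < d) w s ord0 i *: Ad (c s) (delta_mx ord0 i)).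
  by apply/funext => s; rewrite AdE linear_rV_sum.
apply: is_derive_eq.
  apply: is_derive_bigsum => i _; apply: is_derive_scale.
    exact: ((is_derive_rV _ _ _).1 Hw i).
  exact: Ad_is_derive_cst cv.
rewrite big_split /= AdE linearD/=; congr (_ + _); last by rewrite linear_rV_sum.
rewrite {2}(row_sum_delta (w t)).
rewrite lie_bracket_sumr.
by rewrite linear_sum; apply: eq_bigr => i _; rewrite lie_bracketZr linearZ.
Qed.

(** Differentiate Ad g (Ad c w) = Ad (g c g^-1) (Ad g w) along a curve c through 1 with velocity
    v. *)
Lemma Ad_lie_bracket g v w : Ad g (lie_bracket G v w) = lie_bracket G (Ad g v) (Ad g w).
Proof.
have [c c0 cv] := has_velocity_exists (1%g : G) v.
have c1 : (g * c 0 * g^-1)%g = 1%g by rewrite c0 mulg1 mulgV.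
apply: (is_derive_uniq (is_derive_linear (Ad_lin g) (Ad_is_derive_at1 w cv c0))
  (Ad_is_derive_at1 (Ad g w) (conj_velocity g cv c0) c1)) => s /=.
by rewrite -AdE -!AdM mulgVK.
Qed.

End Bracket.

(** * One-parameter subgroups *)

Section Exponential.
Context {R : realType} {d : nat} {G : lieGroupType R d}.
Implicit Types (g h : G) (c a b : R -> G) (v w : 'rV[R]_d) (t : R).

Local Notation k1 := (chart_at (1%g : G)).
Local Notation phi := (cmap k1).
Local Notation psi := (cinv k1).
Local Notation e := (phi 1%g).

(** In the chart at 1, the left-invariant field of v is u |-> ['D_(0, v) chart_mul (u, e)]; its
    integral curves give curves of constant left velocity. *)
Lemma left_velocity_coord c t v : {for t, continuous c} -> cdom k1 (c t) ->
  is_derive t 1 (phi \o c) ('D_(0, v) (@chart_mul R d G) (phi (c t), e)) ->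
  left_velocity c t v.
Proof.
move=> cc kc dc.
have H := chart_has_velocity cc (chart_at_atlas 1%g) kc dc.
have [a a0 av] := has_velocity_exists (1%g : G) v.
have d1 := velocity1_is_derive av a0.
have ca : {for 0, continuous a} by case: av.
have cg : {for (0 : R), continuous (fun=> c t)} by exact: cvg_cst.
have cE : (c t * a 0)%g = c t by rewrite a0 mulg1.
have kca : cdom k1 (c t * a 0)%g by rewrite cE.
have ka : cdom k1 (a 0) by rewrite a0; exact: cdom1.
have d2 := chart_mul_is_derive cg ca kc ka kca (is_derive_cst _ _ _) d1.
have cca : {for (0 : R), continuous (fun s => c t * a s)%g} by exact: continuous_mulg.
have H2 := chart_has_velocity cca (chart_at_atlas 1%g) kca d2.
have H3 := dL_velocity (c t) av a0.
have := has_velocity_uniq H2 H3.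
have mc : @chart_mul_dom R d G (phi (c t), e) by apply: chart_mul_domP; rewrite ?mulg1//; exact: cdom1.
rewrite cE a0 -(deriveE _ (chart_mul_differentiable mc)).
by rewrite /left_velocity => <-.
Qed.

Lemma local_flow v : exists (r : R) (c : R -> G),
  [/\ 0 < r, c 0 = 1%g & forall t, `|t| < r -> left_velocity c t v].
Proof.
pose U : set 'rV[R]_d := phi @` cdom k1.
pose f u := 'D_(0, v) (@chart_mul R d G) (u, e).
have Ue : U e by exists 1%g => //; exact: cdom1.
have Udom u : U u -> @chart_mul_dom R d G (u, e).
  by move=> [g kg <-]; apply: chart_mul_domP; rewrite ?mulg1//; exact: cdom1.
have dpair u : differentiable (fun u : 'rV[R]_d => (u, e)) u.
  by apply: differentiable_pair => //; exact: differentiable_cst.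
have df u : U u -> differentiable f u.
  move=> Uu.
  apply: (@differentiable_comp _ _ _ _ (fun u => (u, e)) ('D_(0, v) (@chart_mul R d G))) => //.
  exact/derive_chart_mul_differentiable/Udom.
(* Derivatives of the field are second derivatives of the multiplication, hence continuous; this
   yields the Lipschitz bound. *)
have Df w u : U u -> 'D_w f u = 'D_(w, 0) ('D_(0, v) (@chart_mul R d G)) (u, e).
  move=> Uu; rewrite deriveE; last exact: df.
  have dm := derive_chart_mul_differentiable (0, v) (Udom u Uu).
  rewrite (deriveE _ dm).
  have -> : f = 'D_(0, v) (@chart_mul R d G) \o (fun u => (u, e)) by [].
  rewrite diff_comp//=.
  have dp : is_diff u (fun u => (u, e)) (fun w => (w, 0)).
    exact: (is_diff_pair (is_diff_id u) (is_diff_cst e u)).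
  by rewrite diff_val.
have cf w u : U u -> {for u, continuous ('D_w f)}.
  move=> Uu.
  have c1 : {for u, continuous (fun u => 'D_(w, 0) ('D_(0, v) (@chart_mul R d G)) (u, e))}.
    apply: (@continuous_comp _ _ _ (fun u => (u, e)) ('D_(w, 0) ('D_(0, v) (@chart_mul R d G)))).
      exact: differentiable_continuous.
    exact/derive2_chart_mul_continuous/Udom.
  have nU : \forall x \near u, U x.
    by apply: open_nbhs_nbhs; split => //; exact: cimg_open.
  have hD : \forall x \near u, 'D_(w, 0) ('D_(0, v) (@chart_mul R d G)) (x, e) = 'D_w f x.
    by apply: filterS nU => x Ux; rewrite Df.
  rewrite /prop_for /continuous_at (Df _ _ Uu).
  exact: cvg_trans (near_eq_cvg hD) c1.
have [r [L [r0 L0 rU fL]]] := C1_locally_lipschitz (@cimg_open _ _ _ k1) Ue df cf.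
have [ee [u [e0 u0 ur du]]] := picard_lindelof r0 L0 fL.
exists ee, (psi \o u); split => //.
  by rewrite /= u0 psi_e.
move=> t te; have [k uE] := chart_cmapK (rU _ (ur t)).
apply: left_velocity_coord; [|exact: k|].
- apply: continuous_comp.
    by apply/differentiable_continuous/derivable1_diffP; have [] := du t te.
  by apply: cinv_continuous; exact/rU/ur.
- rewrite uE; apply: near_eq_is_derive (du t te); near=> s => /=.
  by rewrite (chart_cmapK (rU _ (ur s))).2.
Unshelve. all: by end_near. Qed.

Lemma left_velocity_shift c t v (q : R) : left_velocity c (t + q) v ->
  left_velocity (fun s => c (s + q)) t v.
Proof.
rewrite /left_velocity => H.
have := @has_velocity_affine _ _ _ c t (dL (c (t + q)) v) 1 q.
have -> : (fun s => c (1 * s + q)) = (fun s => c (s + q)).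
  by apply/funext => s; rewrite mul1r.
by rewrite mul1r scale1r; apply.
Qed.

Lemma one_parameter_subgroup_exists v : exists c : R -> G, one_parameter_subgroup v c.
Proof.
have [r [c [r0 c0 cv]]] := local_flow v.
(* For fixed s, both t |-> c (t + s) and t |-> c s c t have left velocity v and start at c s. *)
have cD s t : `|s| + `|t| < r -> c (s + t) = (c s * c t)%g.
  move=> st.
  rewrite addrC.
  apply: (@left_velocity_eq _ _ _ (fun t => c (t + s)) (fun t => c s * c t)%g
    (fun=> v) (r - `|s|)).
  - by rewrite add0r c0 mulg1.
  - move=> x xr; apply: left_velocity_shift; apply: cv.
    by apply: le_lt_trans (ler_normD _ _) _; rewrite -ltrBrDr.
  - move=> x xr; apply: left_velocity_mull; apply: cv.
    by apply: lt_le_trans xr _; rewrite lerBlDr lerDl.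
  - by rewrite ltrBrDr addrC.
have cX k s : k%:R * `|s| < r -> c (k%:R * s) = (c s ^+ k)%g.
  elim: k => [|k IH] ks; first by rewrite mul0r c0.
  have ks' : k%:R * `|s| + `|s| < r by move: ks; rewrite -natr1 mulrDl mul1r.
  rewrite -natr1 mulrDl mul1r cD ?normrM ?normr_nat//.
  by rewrite IH ?expgSr// (le_lt_trans _ ks')// lerDl.
pose C N t := (c (t / N.+1%:R)%R ^+ N.+1)%g.
(* Two subdivisions of t are compared through their common refinement into (M + 1)(N + 1) steps. *)
have CM N M t : `|t| / N.+1%:R < r ->
    C N t = (c (t / (M.+1%:R * N.+1%:R))%R ^+ (M.+1 * N.+1)%N)%g.
  move=> tN; rewrite /C expgnA; congr (_ ^+ _)%g.
  have M0 : M.+1%:R != 0 :> R by rewrite pnatr_eq0.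
  have N0 : N.+1%:R != 0 :> R by rewrite pnatr_eq0.
  rewrite -cX.
    by congr c; move: M0 N0; move: (M.+1%:R : R) (N.+1%:R : R) => x y x0 y0; field; rewrite x0 y0.
  rewrite normrM normfV normrM !normr_nat.
  suff -> : M.+1%:R * (`|t| / (M.+1%:R * N.+1%:R)) = `|t| / N.+1%:R by [].
  by move: M0 N0; move: (M.+1%:R : R) (N.+1%:R : R) => x y x0 y0; field; rewrite x0 y0.
have CE N M t : `|t| / N.+1%:R < r -> `|t| / M.+1%:R < r -> C N t = C M t.
  by move=> tN tM; rewrite (CM N M)// (CM M N)// [M.+1%:R * _]mulrC [(M.+1 * _)%N]mulnC.
(* Enough steps to bring t / (n t + 1) below r / 2: the half is there because additivity of c
   requires the sum of two such steps to stay below r. *)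
pose n t := Num.truncn (2 * `|t| / r).
have nP t N : (n t <= N)%N -> `|t| / N.+1%:R < r / 2.
  move=> nN; rewrite ltr_pdivrMr ?ltr0n//.
  have := truncnS_gt (2 * `|t| / r); rewrite -/(n t) => H.
  have {}H : 2 * `|t| / r < N.+1%:R.
    by apply: lt_le_trans H _; rewrite ler_nat ltnS.
  move: H; rewrite ltr_pdivrMr// => H.
  by rewrite mulrAC ltr_pdivlMr// mulrC [r * _]mulrC.
have r2 : r / 2 < r by rewrite ltr_pdivrMr// ltr_pMr// ltr1n.
have nP' t N : (n t <= N)%N -> `|t| / N.+1%:R < r.
  by move=> /nP/lt_trans; exact.
exists (fun t => C (n t) t); split.
  move=> s t; pose N := maxn (n (s + t)) (maxn (n s) (n t)).
  have [h1 h2 h3] : [/\ (n (s + t)%R <= N)%N, (n s <= N)%N & (n t <= N)%N].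
    by rewrite /N !leq_max !leqnn !orbT.
  rewrite (CE _ N (s + t)) ?nP'// (CE _ N s) ?nP'// (CE _ N t) ?nP'//.
  rewrite /C mulrDl.
  have sr : `|s / N.+1%:R| < r / 2 by rewrite normrM normfV normr_nat nP.
  have tr : `|t / N.+1%:R| < r / 2 by rewrite normrM normfV normr_nat nP.
  have str : `|s / N.+1%:R| + `|t / N.+1%:R| < r by rewrite [r]splitr ltrD.
  (* The small factors commute, both products being the value of c at the sum of the times. *)
  rewrite cD// expgMn// /commute -cD// addrC cD// addrC//.
apply: (@near_has_velocity _ _ _ c); last first.
  by apply/(left_velocity1 v c0)/cv; rewrite normr0.
near=> t; have tr : `|t| < r.
  near: t; apply: (@cvgr_norm_lt _ _ _ _ _ id 0); [exact: cvg_id|by rewrite normr0].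
have tr1 : `|t| / 1%:R < r by rewrite divr1.
by rewrite (CE _ 0%N t (nP' _ _ (leqnn _)) tr1) /C divr1 expg1.
Unshelve. all: by end_near. Qed.

Lemma one_parameter_subgroup1 v c : one_parameter_subgroup v c -> c 0 = 1%g.
Proof.
move=> [cD _]; have := cD 0 0; rewrite addr0 => /esym/eqP.
by rewrite -[X in _ == X]mulg1 => /eqP/mulgI.
Qed.

Lemma one_parameter_subgroup_velocity v c t : one_parameter_subgroup v c ->
  left_velocity c t v.
Proof.
move=> oc; have c0 := one_parameter_subgroup1 oc; have [cD cv] := oc.
have H := (left_velocity1 v c0).2 cv.
have -> : c = (fun s => c t * c (s + - t))%g by apply/funext => s; rewrite -cD addrC subrK.
by apply/left_velocity_mull/left_velocity_shift; rewrite subrr.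
Qed.

Lemma one_parameter_subgroup_uniq v c c' : one_parameter_subgroup v c ->
  one_parameter_subgroup v c' -> c = c'.
Proof.
move=> oc oc'; apply/funext => t.
apply: (@left_velocity_eq _ _ _ c c' (fun=> v) (`|t| + 1)).
- by rewrite (one_parameter_subgroup1 oc) (one_parameter_subgroup1 oc').
- by move=> s _; exact: one_parameter_subgroup_velocity.
- by move=> s _; exact: one_parameter_subgroup_velocity.
- by rewrite ltrDl.
Qed.

(** Uniqueness of one-parameter subgroups makes the choice in [lie_exp] irrelevant. *)
Lemma lie_expE v c : one_parameter_subgroup v c -> lie_exp G v = c 1.
Proof.
move=> oc; rewrite /lie_exp; case: xgetP => [_ -> [c' oc' ->]|/(_ (c 1))].
  by rewrite (one_parameter_subgroup_uniq oc oc').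
by case; exists c.
Qed.

Lemma one_parameter_subgroup_scale v c (x : R) : one_parameter_subgroup v c ->
  one_parameter_subgroup (x *: v) (fun t => c (x * t)).
Proof.
move=> oc; have [cD cv] := oc; split => [s t|]; first by rewrite mulrDr cD.
have := @has_velocity_affine _ _ _ c 0 v x 0.
rewrite mulr0 addr0 => /(_ cv).
by under eq_fun do rewrite addr0.
Qed.

Lemma lie_exp_subgroup v : one_parameter_subgroup v (fun t => lie_exp G (t *: v)).
Proof.
have [c oc] := one_parameter_subgroup_exists v.
suff -> : (fun t => lie_exp G (t *: v)) = c by [].
apply/funext => t; rewrite (lie_expE (one_parameter_subgroup_scale t oc)).
by rewrite mulr1.
Qed.

Lemma lie_exp_velocity v t : left_velocity (fun t => lie_exp G (t *: v)) t v.
Proof. exact/one_parameter_subgroup_velocity/lie_exp_subgroup. Qed.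

Lemma lie_exp0 : lie_exp G 0 = 1%g.
Proof. by have /one_parameter_subgroup1 := lie_exp_subgroup 0; rewrite scale0r. Qed.

Lemma lie_expN v : lie_exp G (- v) = (lie_exp G v)^-1%g.
Proof.
apply/esym/mulg1_eq; have [H _] := lie_exp_subgroup v.
by have := H 1 (-1); rewrite subrr scale0r lie_exp0 scale1r scaleN1r.
Qed.

(** Conjugation by an element of the one-parameter subgroup of v fixes that subgroup pointwise,
    hence its velocity. *)
Lemma Ad_lie_exp_self v t : Ad (lie_exp G (t *: v)) v = v.
Proof.
have [H _] := lie_exp_subgroup v.
set c := (fun t => lie_exp G (t *: v)) in H *.
have [c0 cv] : c 0 = 1%g /\ has_velocity c 0 v.
  by split; [rewrite /c scale0r lie_exp0|case: (lie_exp_subgroup v)].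
have := conj_velocity (c t) cv c0.
have -> : (fun s => c t * c s * (c t)^-1)%g = c.
  by apply/funext => s; rewrite -H addrC H mulgK.
by move=> /has_velocity_uniq; apply.
Qed.

Lemma lie_bracketvv v : lie_bracket G v v = 0.
Proof.
have [_ cv] := lie_exp_subgroup v.
apply: (is_derive_uniq (Ad_is_derive_at1 v cv _) (is_derive_cst v _ _)) => [|s].
  by rewrite scale0r lie_exp0.
exact: Ad_lie_exp_self.
Qed.

Lemma lie_bracketC v w : lie_bracket G v w = - lie_bracket G w v.
Proof.
apply/eqP; rewrite -addr_eq0; apply/eqP.
have := lie_bracketvv (v + w).
by rewrite lie_bracketDl !lie_bracketDr !lie_bracketvv add0r addr0.
Qed.

Lemma Ad_lie_exp_is_derive v (w : R -> 'rV[R]_d) dw t : is_derive t 1 w dw ->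
  is_derive t 1 (fun s => Ad (lie_exp G (s *: v)) (w s))
    (Ad (lie_exp G (t *: v)) (lie_bracket G v (w t) + dw)).
Proof. exact/Ad_is_derive/lie_exp_velocity. Qed.

End Exponential.

(** * Invariant bilinear forms *)

Section Invariance.
Context {R : realType} {d : nat} {G : lieGroupType R d}.

Lemma lie_bracket_lin v : exists L : {linear 'rV[R]_d -> 'rV[R]_d},
  lie_bracket G v = L :> (_ -> _).
Proof.
have lin : linear (lie_bracket G v).
  by move=> x w w'; rewrite lie_bracketDr lie_bracketZr.
pose LM := GRing.isLinear.Build _ _ _ _ _ lin.
by pose L : {linear _ -> _} := HB.pack (lie_bracket G v) LM; exists L.
Qed.

(* The component z of Ad (exp tx) v outside U solves the linear equation
   z' = P [x, z], where P is the projection along U. *)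
Lemma Ad_lie_exp_stable (U : {vspace 'rV[R]_d}) x :
  (forall w, w \in U -> lie_bracket G x w \in U) ->
  forall v, v \in U -> Ad (lie_exp G x) v \in U.
Proof.
move=> xU v vU.
have [P PE] : exists P : {linear 'rV[R]_d -> 'rV[R]_d}, forall w, P w = w - projv U w.
  by exists (\1%VF - projv U : 'End('rV[R]_d)) => w /=; rewrite add_lfunE opp_lfunE id_lfunE.
have P0 w : w \in U -> P w = 0 by move=> wU; rewrite PE projv_id// subrr.
have [L LE] := lie_bracket_lin x.
have PL a b : b \in U -> P (L (a + b)) = P (L a).
  move=> bU; have Pb : P (L b) = 0 by apply: P0; rewrite -LE xU.
  by rewrite linearD linearD Pb addr0.
pose y t := Ad (lie_exp G (t *: x)) v.
have dy (t : R) : is_derive t 1 y (lie_bracket G x (y t)).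
  have := Ad_lie_exp_is_derive (G := G) x (is_derive_cst v t 1).

  by rewrite addr0 Ad_lie_bracket Ad_lie_exp_self.
have z1 : (P \o y) 1 = 0.
  apply: (@linear_ode_zero _ _ (P \o L)%FUN) => //.
    move=> t.
    have E : P (lie_bracket G x (y t)) = P (L (P (y t))).
      rewrite LE -[in LHS](subrK (projv U (y t)) (y t)) -PE.
      exact/PL/memv_proj.
    by apply: is_derive_eq (is_derive_linear P (dy t)) _; exact: E.
  by rewrite /= /y scale0r lie_exp0 Ad1 P0.
move: z1; rewrite /= PE /y scale1r => /eqP; rewrite subr_eq0 => /eqP ->.
exact: memv_proj.
Qed.

Definition invariant_form (B : 'rV[R]_d -> 'rV[R]_d -> R) : Prop :=
  [/\ forall a v v' w, B (a *: v + v') w = a * B v w + B v' w,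
      forall v w, B v w = B w v
    & forall (g : G) v w, B (Ad g v) (Ad g w) = B v w].

(** The trace is cyclic, and ad (Ad g v) is conjugate to ad v by Ad g. Matrices act on rows from the
    right, so composites appear in reversed order. *)
Lemma killing_form_invariant : invariant_form (killing_form G).
Proof.
have lE v w : exists M : 'M[R]_d * 'M[R]_d,
  [/\ forall u, lie_bracket G v u = u *m M.1, forall u, lie_bracket G w u = u *m M.2,
  killing_form G v w = \tr (M.2 *m M.1) & killing_form G w v = \tr (M.1 *m M.2)].
  have [L LE] := lie_bracket_lin v; have [L' L'E] := lie_bracket_lin w.
  exists (lin1_mx L, lin1_mx L'); split => /= [u|u||].
  - by rewrite mul_rV_lin1 LE.
  - by rewrite mul_rV_lin1 L'E.
  - rewrite /killing_form LE L'E; congr (\tr _).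
    by apply/row_matrixP => i; rewrite !rowE mulmxA !mul_rV_lin1.
  - rewrite /killing_form LE L'E; congr (\tr _).
    by apply/row_matrixP => i; rewrite !rowE mulmxA !mul_rV_lin1.
split=> [a v v' w|v w|g v w].
- rewrite /killing_form /mxtrace mulr_sumr -big_split; apply: eq_bigr => i _ /=.
  by rewrite !mxE /= lie_bracketDl lie_bracketZl !mxE.
- by have [[M N] [_ _ /= -> ->]] := lE v w; rewrite mxtrace_mulC.
- have [[M N] [/= ME NE -> _]] := lE v w.
  have [[M' N'] [/= ME' NE' -> _]] := lE (Ad g v) (Ad g w).
  have [A AE] : exists A : 'M[R]_d, forall u, u *m A = Ad g u.
    by exists (lin1_mx (Ad_lin g)) => u; exact: mul_rV_lin1.
  have [A' AE'] : exists A : 'M[R]_d, forall u, u *m A = Ad g^-1%g u.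
    by exists (lin1_mx (Ad_lin g^-1%g)) => u; exact: mul_rV_lin1.
  have AA' : A *m A' = 1%:M.
    by apply/row_matrixP => i; rewrite !rowE mulmxA AE AE' AdK mulmx1.
  have EM (M1 M1' : 'M[R]_d) u : (forall x, lie_bracket G u x = x *m M1) ->
      (forall x, lie_bracket G (Ad g u) x = x *m M1') -> M1' = A' *m M1 *m A.
    move=> H H'; apply/row_matrixP => i; rewrite !rowE !mulmxA -H' AE' -H AE.
    by rewrite Ad_lie_bracket AdVK.
  rewrite (EM _ _ _ ME ME') (EM _ _ _ NE NE').
  rewrite -!mulmxA (mulmxA A) AA' mul1mx mxtrace_mulC -!mulmxA.
  by rewrite AA' mulmx1.
Qed.

Variable B : 'rV[R]_d -> 'rV[R]_d -> R.
Hypothesis BP : invariant_form B.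

Let BL := let: And3 h _ _ := BP in h.
Let BC := let: And3 _ h _ := BP in h.
Let BA := let: And3 _ _ h := BP in h.

Lemma formDl v v' w : B (v + v') w = B v w + B v' w.
Proof. by have := BL 1 v v' w; rewrite scale1r mul1r. Qed.

Lemma form0l w : B 0 w = 0.
Proof. by have := formDl 0 0 w; rewrite addr0 => /eqP; rewrite -subr_eq subrr eq_sym => /eqP. Qed.

Lemma formZl a v w : B (a *: v) w = a * B v w.
Proof. by have := BL a v 0 w; rewrite addr0 form0l addr0. Qed.

Lemma formC v w : B v w = B w v. Proof. exact: BC. Qed.

Lemma formDr v w w' : B v (w + w') = B v w + B v w'.
Proof. by rewrite formC formDl !(formC v). Qed.

Lemma form0r v : B v 0 = 0. Proof. by rewrite formC form0l. Qed.

Lemma formZr a v w : B v (a *: w) = a * B v w.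
Proof. by rewrite formC formZl formC. Qed.

Lemma formNl v w : B (- v) w = - B v w.
Proof. by rewrite -scaleN1r formZl mulN1r. Qed.

Lemma form_suml w I (r : seq I) (P : pred I) (F : I -> 'rV[R]_d) :
  B (\sum_(i <- r | P i) F i) w = \sum_(i <- r | P i) B (F i) w.
Proof. exact: (big_morph (B^~ w) (fun x y => formDl x y w) (form0l w)). Qed.

Lemma form_sumr v I (r : seq I) (P : pred I) (F : I -> 'rV[R]_d) :
  B v (\sum_(i <- r | P i) F i) = \sum_(i <- r | P i) B v (F i).
Proof. exact: (big_morph (B v) (formDr v) (form0r v)). Qed.

Lemma form_Ad (g : G) v w : B (Ad g v) w = B v (Ad g^-1%g w).
Proof. by rewrite -{1}(AdVK g w) BA. Qed.

(** The derivative at t = 0 of B (Ad (exp tx) v) w = B v (Ad (exp (-tx)) w). *)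
Lemma form_lie_bracket x v w : B (lie_bracket G x v) w = - B v (lie_bracket G x w).
Proof.
have lin z : exists L : {linear 'rV[R]_d -> R^o}, forall u, B u z = L u.
  have l : linear (B^~ z : _ -> R^o) by move=> a u u'; rewrite BL.
  pose LM := GRing.isLinear.Build _ _ _ _ _ l.
  by pose L : {linear _ -> _} := HB.pack (B^~ z : _ -> R^o) LM; exists L.
have [Lw LwE] := lin w; have [Lv LvE] := lin v.
have d1 := is_derive_linear Lw (Ad_lie_exp_is_derive (G := G) x (is_derive_cst v (0 : R) 1)).
have d2 := is_derive_linear Lv (Ad_lie_exp_is_derive (G := G) (- x) (is_derive_cst w (0 : R) 1)).
have E (t : R) : Lw (Ad (lie_exp G (t *: x)) v) = Lv (Ad (lie_exp G (t *: - x)) w).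
  by rewrite -LwE -LvE scalerN lie_expN form_Ad formC.
have := is_derive_uniq d1 d2 E.
rewrite !scale0r lie_exp0 !Ad1 !addr0 -LwE -LvE => ->.
by rewrite -scaleN1r lie_bracketZl formZl mulN1r (formC v).
Qed.

End Invariance.
Arguments invariant_form {R d} G B.

(** * Chains of subalgebras *)

Section OrthogonalChain.
Context {R : realType} {d : nat} {G : lieGroupType R d}.
Variables (n : nat) (gs p : nat -> {vspace 'rV[R]_d}) (B : 'rV[R]_d -> 'rV[R]_d -> R).
Hypotheses (BP : invariant_form G B)
  (gs_subalgebra : forall i, (i <= n)%N -> lie_subalgebra G (gs i))
  (gs_sub : forall i, (i < n)%N -> (gs i <= gs i.+1)%VS)
  (gs_last : gs n = fullv)
  (B_nondeg : forall i, (i <= n)%N -> nondegenerate_on B (gs i))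
  (p_zero : p 0%N = gs 0%N)
  (p_succ : forall i, (i < n)%N -> forall v,
       v \in p i.+1 <->
       v \in gs i.+1 /\ (forall w, w \in gs i -> B v w = 0)).

(** B may be indefinite, so the argument counts dimensions: pairing with a basis of U is injective
    on U by nondegeneracy, hence maps U onto all coordinate vectors, and some u in U has the same
    pairings as v. *)
Lemma orthogonal_decomposition (U : {vspace 'rV[R]_d}) v : nondegenerate_on B U ->
  exists2 u, u \in U & forall w, w \in U -> B (v - u) w = 0.
Proof.
move=> ndU.
have lin : linear (fun v : 'rV[R]_d => \row_(j < \dim U) B v (vbasis U)`_j).
  by move=> a x y; apply/rowP => j; rewrite !mxE (formDl BP) (formZl BP).
pose LM := GRing.isLinear.Build _ _ _ _ _ lin.
pose L : {linear 'rV[R]_d -> 'rV[R]_(\dim U)} := HB.pack (fun v : 'rV[R]_d => _) LM.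
pose f := linfun L.
have fE x j : f x ord0 j = B x (vbasis U)`_j by rewrite lfunE mxE.
have f0 x y : f x = f y -> forall w, w \in U -> B (x - y) w = 0.
  move=> fxy w wU; rewrite (coord_vbasis wU) (form_sumr BP) big1// => j _.
  by rewrite (formZr BP) (formDl BP) (formNl BP) -!fE fxy subrr mulr0.
have kerU : (U :&: lker f = 0)%VS.
  apply/eqP; rewrite -subv0; apply/subvP => x; rewrite memv_cap memv_ker memv0.
  move=> /andP[xU /eqP fx]; apply/eqP/(ndU x xU) => w wU.
  by have := f0 x 0; rewrite linear0 subr0; apply.
have fU : (f @: U = fullv)%VS.
  apply/eqP; rewrite eqEdim subvf/= dimvf (limg_dim_eq kerU).
  by rewrite [leqLHS]mul1n.
have : f v \in (f @: U)%VS by rewrite fU memvf.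
by move=> /memv_imgP[u uU fvu]; exists u => // w wU; exact: f0.
Qed.

Lemma gs_mono i j : (i <= j <= n)%N -> (gs i <= gs j)%VS.
Proof.
move=> /andP[]; elim: j => [|j IH]; first by rewrite leqn0 => /eqP->.
rewrite leq_eqVlt => /predU1P[->//|]; rewrite ltnS => ij jn.
exact: subv_trans (IH ij (ltnW jn)) (gs_sub jn).
Qed.

Lemma p_sub_gs i : (i <= n)%N -> (p i <= gs i)%VS.
Proof.
case: i => [_|i iltn]; first by rewrite p_zero.
by apply/subvP => v /(p_succ iltn)[].
Qed.

Lemma p_orthogonal i j v w : (i < j <= n)%N -> v \in p j -> w \in gs i -> B v w = 0.
Proof.
case: j => // j /andP[ij jn] /(p_succ jn)[_ H] wi; apply: H.
by apply: subvP wi; apply: gs_mono; rewrite -ltnS ij ltnW.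
Qed.

Lemma p_orthogonal_p i j v w : (i <= n)%N -> (j <= n)%N -> i != j ->
  v \in p i -> w \in p j -> B v w = 0.
Proof.
move=> iN jN; rewrite neq_ltn => /orP[] ij vi wj.
  by rewrite (formC BP) (@p_orthogonal i j)// ?ij// (subvP (p_sub_gs iN)).
by rewrite (@p_orthogonal j i)// ?ij// (subvP (p_sub_gs jN)).
Qed.

Lemma gs_sum i : (i <= n)%N -> (gs i <= \sum_(0 <= j < i.+1) p j)%VS.
Proof.
elim: i => [|i IH] iN; first by rewrite big_nat1 p_zero.
rewrite big_nat_recr//=; apply/subvP => v vi.
have [u ui uo] := orthogonal_decomposition v (B_nondeg (ltnW iN)).
rewrite -(subrK u v) addrC; apply: memv_add; first exact: (subvP (IH (ltnW iN))).
apply/(p_succ iN); split=> //; apply: memvB => //.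
by apply: subvP ui; exact: gs_sub.
Qed.

Lemma sum_p_full : (\sum_(0 <= j < n.+1) p j)%VS = fullv.
Proof.
by apply: subv_anti; rewrite subvf/= -gs_last; exact: gs_sum.
Qed.

Local Notation pr := (chain_pr n p).
Local Notation prs := (chain_sub n p).

Lemma pr_mem i x : pr i x \in p i. Proof. exact: memv_sum_pi. Qed.

Lemma pr_sum x : \sum_(0 <= i < n.+1) pr i x = x.
Proof. by apply: sumv_pi_nat_sum; rewrite sum_p_full memvf. Qed.

Lemma pr_lin i : exists L : {linear 'rV[R]_d -> 'rV[R]_d}, forall x, pr i x = L x.
Proof. by exists (sumv_pi (\sum_(0 <= j < n.+1) p j)%VS i). Qed.

Lemma sum_p_orthogonal (y : nat -> 'rV[R]_d) k w : (k <= n)%N ->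
  (forall i, (i <= n)%N -> y i \in p i) -> w \in p k ->
  B (\sum_(0 <= i < n.+1) y i) w = B (y k) w.
Proof.
move=> kn yp wk; rewrite (form_suml BP) (bigD1_seq k) ?iota_uniq//=; last first.
  by rewrite mem_index_iota.
rewrite big_nat_cond big1 ?addr0// => i /andP[/andP[_ iN] ik].
by apply: (p_orthogonal_p _ kn ik) wk => //; exact: yp.
Qed.

(** The difference y_k - z_k is orthogonal to p_i for i <> k by orthogonality of the summands, and
    to p_k because the two sums pair equally with p_k; nondegeneracy on g_n concludes. *)
Lemma sum_p_inj (y z : nat -> 'rV[R]_d) k : (k <= n)%N ->
  (forall i, (i <= n)%N -> y i \in p i) -> (forall i, (i <= n)%N -> z i \in p i) ->
  \sum_(0 <= i < n.+1) y i = \sum_(0 <= i < n.+1) z i -> y k = z k.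
Proof.
move=> kn yp zp yz; apply/eqP; rewrite -subr_eq0; apply/eqP.
have dk : y k - z k \in p k by rewrite memvB ?yp ?zp.
apply: (B_nondeg (leqnn n)) => [|w _]; first by rewrite gs_last memvf.
rewrite -(pr_sum w) (form_sumr BP) big_nat_cond big1// => i /andP[/andP[_ iN] _].
have [->|ki] := eqVneq k i; last first.
  by apply: (p_orthogonal_p kn _ ki dk); [exact: iN|exact: pr_mem].
rewrite (formDl BP) (formNl BP).
rewrite -(sum_p_orthogonal _ yp (pr_mem i w))// -(sum_p_orthogonal _ zp (pr_mem i w))//.
by rewrite yz subrr.
Qed.

(** [sumv_pi] supplies components that add up to the vector; uniqueness of the decomposition
    identifies them. *)
Lemma pr_sum_id (y : nat -> 'rV[R]_d) k : (k <= n)%N ->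
  (forall i, (i <= n)%N -> y i \in p i) -> pr k (\sum_(0 <= i < n.+1) y i) = y k.
Proof.
move=> kn yp; set x := \sum_(0 <= i < n.+1) y i.
apply: (@sum_p_inj (pr^~ x) y k kn) => // [i _|]; first exact: pr_mem.
exact: pr_sum.
Qed.

Lemma prs_mem i x : (i <= n)%N -> prs i x \in gs i.
Proof.
move=> iN; rewrite /chain_sub big_nat; apply: memv_suml => j /andP[_ ji].
apply: subvP (pr_mem j x); apply: subv_trans (p_sub_gs _) _; first exact: leq_trans iN.
by apply: gs_mono; rewrite -ltnS ji.
Qed.

Lemma prsS i x : prs i.+1 x = prs i x + pr i.+1 x.
Proof. by rewrite /chain_sub big_nat_recr. Qed.

Lemma prs_last x : prs n x = x. Proof. exact: pr_sum. Qed.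

(** Bracketing with v preserves the subalgebras g_i and g_{i-1}; being skew for B, it preserves the
    orthogonal complement of the second in the first. *)
Lemma lie_bracket_p i j v w : (j < i <= n)%N -> v \in gs j -> w \in p i ->
  lie_bracket G v w \in p i.
Proof.
case: i => // i /andP[ji iN] vj wp.
have vi : v \in gs i by apply: subvP vj; apply: gs_mono; rewrite -ltnS ji ltnW.
have [wi wo] := (p_succ iN w).1 wp.
apply/(p_succ iN); split.
  apply: gs_subalgebra => //; apply: subvP vi; exact: gs_sub.
move=> u ui; rewrite (form_lie_bracket BP) wo ?oppr0//.
by apply: gs_subalgebra => //; exact: ltnW.
Qed.

Lemma Ad_p i j v w : (j < i <= n)%N -> v \in gs j -> w \in p i ->
  Ad (lie_exp G v) w \in p i.
Proof.
move=> ji vj wp; apply: Ad_lie_exp_stable wp => u; exact: lie_bracket_p ji vj.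
Qed.

(** * The Hamiltonian equations as an Euler equation and in components *)

Section Hamiltonian.
Variable s : nat -> R.

(** The gradient of the Hamiltonian with respect to B. *)
Definition chain_velocity (x : 'rV[R]_d) := \sum_(0 <= j < n.+1) s j *: pr j x.
Local Notation omega := chain_velocity.

Let reduced i x :=
  lie_bracket G (\sum_(0 <= j < i) (s i - s j) *: pr j x) (pr i x).

(** Adding the summand x_m creates the cross terms [x_0 + ... + x_{m-1}, s_m x_m] and
    [x_m, s_0 x_0 + ... + s_{m-1} x_{m-1}], whose sum is the m-th reduced right-hand side. *)
Lemma sum_reduced x : \sum_(0 <= i < n.+1) reduced i x = lie_bracket G x (omega x).
Proof.
rewrite -{2}(pr_sum x) /omega; elim: n.+1 => [|m IH].
  by rewrite !big_geq// lie_bracket0l.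
rewrite !(big_nat_recr m)//= IH lie_bracketDl !lie_bracketDr !lie_bracketZr lie_bracketvv.
rewrite scaler0 addr0 -addrA; congr (_ + _); rewrite /reduced.
rewrite (lie_bracketC (pr m x)) -lie_bracketZl -scaleN1r -lie_bracketZl -lie_bracketDl.
congr (lie_bracket G _ _); rewrite scaler_sumr scaler_sumr -big_split/=.
by apply: eq_bigr => j _; rewrite scaleN1r scalerBl.
Qed.

Lemma pr_bracket_omega x i : (i <= n)%N ->
  pr i (lie_bracket G x (omega x)) = reduced i x.
Proof.
move=> iN; rewrite -sum_reduced; apply: (@pr_sum_id (reduced^~ x)) => // j jN.
rewrite /reduced; case: j jN => [_|j jN].
  by rewrite big_geq// lie_bracket0l mem0v.
apply: (@lie_bracket_p _ j); rewrite ?ltnSn//; last exact: pr_mem.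
rewrite big_nat; apply: memv_suml => k /andP[_ kj]; apply: memvZ.
apply: subvP (pr_mem k x); apply: subv_trans (p_sub_gs _) _.
  by apply: leq_trans (ltnW jN); rewrite -ltnS.
by apply: gs_mono; rewrite -ltnS kj ltnW.
Qed.

(** Along a line H is a quadratic polynomial in the parameter; orthogonality of the summands turns
    its linear coefficient into B (omega x) v. *)
Lemma chain_hamiltonian_derive x v :
  'D_v (chain_hamiltonian n p s B) x = B (omega x) v.
Proof.
rewrite derive_line.
pose H1 := \sum_(0 <= i < n.+1) s i / 2 * B (pr i x) (pr i x).
pose H2 := \sum_(0 <= i < n.+1) s i * B (pr i x) (pr i v).
pose H3 := \sum_(0 <= i < n.+1) s i / 2 * B (pr i v) (pr i v).
have -> : (fun h : R => chain_hamiltonian n p s B (h *: v + x)) =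
    (fun h => H1 + H2 * h + H3 * (h * h)).
  apply/funext => h; rewrite /chain_hamiltonian /H1 /H2 /H3 !mulr_suml -!big_split/=.
  apply: eq_bigr => i _; rewrite /chain_pr linearP/= -/(pr i v) -/(pr i x).
  rewrite !(formDl BP) !(formDr BP) !(formZl BP) !(formZr BP) (formC BP (pr i v) (pr i x)).
  by field.
have D : is_derive (0 : R) 1 (fun h => H1 + H2 * h + H3 * (h * h)) H2.
  have d1 := is_deriveZ H2 (is_derive_id (0 : R) 1).
  have d2 := is_deriveZ H3 (is_deriveM (is_derive_id (0 : R) 1) (is_derive_id (0 : R) 1)).
  apply: is_derive_eq (is_deriveD (is_deriveD (is_derive_cst H1 (0 : R) 1) d1) d2) _.
  by rewrite /GRing.scale/= !mul0r !addr0 mulr0 addr0 add0r mulr1.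
rewrite derive_val /H2 /omega (form_suml BP) !big_nat; apply: eq_bigr => i /andP[_ iN].
rewrite (formZl BP); congr (_ * _); rewrite !(formC BP (pr i x)) -[in RHS](pr_sum v).
by rewrite (@sum_p_orthogonal (pr^~ v) i)// => [j _|]; exact: pr_mem.
Qed.

Lemma hamiltonian_curveP (g : R -> G) (x : R -> 'rV[R]_d) :
  hamiltonian_curve B (chain_hamiltonian n p s B) g x <->
  solves_reduced G n p s x /\ solves_kinematic n p s x g.
Proof.
have nd v : (forall w, B v w = 0) -> v = 0.
  by move=> H; apply: (B_nondeg (leqnn n)); rewrite ?gs_last ?memvf.
split=> [H|[[H0 Hi] HK] t].
  suff HH (t : R) : has_velocity g t (dL (g t) (omega (x t))) /\
      is_derive t 1 x (lie_bracket G (x t) (omega (x t))).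
    split; last by move=> t; case: (HH t).
    have Hpr i (t : R) : (i <= n)%N -> is_derive t 1 (pr i \o x) (reduced i (x t)).
      move=> iN; have [L LE] := pr_lin i; have [_ dx] := HH t.
      rewrite -pr_bracket_omega// LE; have -> : pr i = L by exact/funext.
      exact: is_derive_linear.
    split=> [t|i t /andP[_ iN]]; last exact: Hpr.
    by have := Hpr 0%N t (leq0n n); rewrite /reduced big_geq// lie_bracket0l.
  have [xi [nu [gxi xnu can]]] := H t.
  have xiE : xi = omega (x t).
    apply/eqP; rewrite -subr_eq0; apply/eqP/nd => w.
    (* Fibre directions determine the velocity in G. *)
    have := can (0, w); rewrite /canonical_form/= chain_hamiltonian_derive.
    rewrite lie_bracket0r !(form0r BP) subr0 addr0 (formC BP w) => h.
    by rewrite (formDl BP) (formNl BP) h subrr.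
  have nuE : nu = lie_bracket G (x t) (omega (x t)).
    apply/eqP; rewrite -subr_eq0; apply/eqP/nd => w.
    (* Base directions, along which H is constant, determine x' through the invariance of B. *)
    have := can (w, 0); rewrite /canonical_form/= derive0 (form0l BP) sub0r.
    rewrite -xiE (lie_bracketC (x t)) opprK (formDl BP) (form_lie_bracket BP).
    by move=> h; rewrite -[RHS]oppr0 -h opprD opprK.
  by rewrite -nuE -xiE.
have dx : is_derive t 1 x (lie_bracket G (x t) (omega (x t))).
  rewrite -sum_reduced.
  have big_le (F : nat -> 'rV[R]_d) : \sum_(0 <= i < n.+1) F i =
      \sum_(i <- index_iota 0 n.+1 | (i <= n)%N) F i.
    rewrite big_nat_cond [RHS]big_seq_cond.
    by apply: eq_bigl => i; rewrite mem_index_iota ltnS !andbT andbb.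
  have xE : (fun u => \sum_(i <- index_iota 0 n.+1 | (i <= n)%N) pr i (x u)) = x.
    by apply/funext => u; rewrite -big_le pr_sum.
  rewrite big_le -[X in is_derive _ _ X]xE.
  apply: is_derive_bigsum => -[_|i iN]; last exact: Hi.
  by rewrite /reduced big_geq// lie_bracket0l.
exists (omega (x t)), (lie_bracket G (x t) (omega (x t))); split => // -[b1 b2].
rewrite /canonical_form/= chain_hamiltonian_derive (lie_bracketC (x t)) (formNl BP).
by rewrite (form_lie_bracket BP) !opprK subrK (formC BP).
Qed.

(** * The explicit solution of the reduced equations and its uniqueness *)

Section Solution.
Variable xbar : 'rV[R]_d.

Local Notation step k t :=
  (Ad (lie_exp G ((t * (s k.+1 - s k)) *: prs k xbar))).

Fixpoint flow (i : nat) (t : R) (v : 'rV[R]_d) :=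
  if i is k.+1 then flow k t (step k t v) else v.

(* [flow i t] is the composite of the i operators Ad in (i). *)
Lemma flowE i t v : (\big[comp/id]_(0 <= k < i) step k t) v = flow i t v.
Proof.
rewrite /index_iota subn0; elim: i v => [|i IH] v; first by rewrite big_nil.
rewrite -[RHS]IH; have -> : iota 0 i.+1 = rcons (iota 0 i) i by rewrite -addn1 iotaD cats1.
elim: (iota 0 i) => [|k r IHr]; first by rewrite big_cons !big_nil.
by rewrite rcons_cons !big_cons /= IHr.
Qed.

Lemma flow_linear i t a v w : flow i t (a *: v + w) = a *: flow i t v + flow i t w.
Proof. by elim: i v w => //= i IH v w; rewrite AdE linearP IH. Qed.

Lemma flow_lin i t : exists L : {linear 'rV[R]_d -> 'rV[R]_d}, forall v, flow i t v = L v.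
Proof.
have lin : linear (flow i t) by move=> a v w; exact: flow_linear.
pose LM := GRing.isLinear.Build _ _ _ _ _ lin.
by pose L : {linear _ -> _} := HB.pack (flow i t) LM; exists L.
Qed.

Lemma flowD i t v w : flow i t (v + w) = flow i t v + flow i t w.
Proof. by have [L LE] := flow_lin i t; rewrite !LE linearD. Qed.

Lemma flowZ i t a v : flow i t (a *: v) = a *: flow i t v.
Proof. by have [L LE] := flow_lin i t; rewrite !LE linearZ. Qed.

Lemma flow_lie_bracket i t v w :
  flow i t (lie_bracket G v w) = lie_bracket G (flow i t v) (flow i t w).
Proof. by elim: i v w => //= i IH v w; rewrite Ad_lie_bracket IH. Qed.

Lemma flow0 i v : flow i 0 v = v.
Proof. by elim: i v => //= i IH v; rewrite mul0r scale0r lie_exp0 Ad1 IH. Qed.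

Lemma flow_p i m t v : (m <= i <= n)%N -> v \in p i -> flow m t v \in p i.
Proof.
move=> /andP[mi iN]; elim: m mi v => //= m IH mi v vi; apply: IH; first exact: ltnW.
apply: (@Ad_p i m); rewrite ?mi//; apply: memvZ; apply: prs_mem.
exact: leq_trans (ltnW mi) iN.
Qed.

Let x_ i t := flow i t (pr i xbar).
Let xs_ i t := \sum_(0 <= j < i.+1) x_ j t.

Lemma step_prs k t : step k t (prs k xbar) = prs k xbar.
Proof. exact: Ad_lie_exp_self. Qed.

Lemma flow_prs i t : flow i t (prs i xbar) = xs_ i t.
Proof.
elim: i => [|i IH]; first by rewrite /xs_ /chain_sub !big_nat1.
by rewrite /xs_ big_nat_recr//= -/(xs_ i t) -IH prsS AdD step_prs flowD.
Qed.

(* [drift i t] is the right velocity of the product of exponentials in (i). *)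
Definition drift i t := \sum_(0 <= k < i) (s k.+1 - s k) *: xs_ k t.

Lemma driftE i t : drift i t = \sum_(0 <= j < i) (s i - s j) *: x_ j t.
Proof.
rewrite /drift; elim: i => [|i IH]; first by rewrite !big_geq.
rewrite !big_nat_recr//= IH /xs_ big_nat_recr//= scalerDr addrA; congr (_ + _).
rewrite scaler_sumr -big_split/=; apply: eq_bigr => j _.
by rewrite -scalerDl; congr (_ *: _); ring.
Qed.

(** The argument may move with time: the induction absorbs the innermost factor into it, and the
    uniqueness proof applies it to [flowV] of a solution. *)
Lemma flow_is_derive i (t : R) (w : R -> 'rV[R]_d) dw : is_derive t 1 w dw ->
  is_derive t 1 (fun t => flow i t (w t))
    (flow i t dw + lie_bracket G (drift i t) (flow i t (w t))).
Proof.
elim: i w dw => [|i IH] w dw Hw /=.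
  by rewrite /drift big_geq// lie_bracket0l addr0.
have H : is_derive t 1 (fun t => step i t (w t))
    (step i t (lie_bracket G ((s i.+1 - s i) *: prs i xbar) (w t) + dw)).
  under eq_fun do rewrite -scalerA.
  by rewrite -scalerA; exact: Ad_lie_exp_is_derive.
apply: is_derive_eq (IH _ _ H) _.
rewrite AdD Ad_lie_bracket AdZ step_prs lie_bracketZl.
rewrite flowD flowZ flow_lie_bracket flow_prs addrAC addrC; congr (_ + _).
by rewrite /drift big_nat_recr//= lie_bracketDl addrC lie_bracketZl.
Qed.

Definition solution t := \sum_(0 <= i < n.+1) x_ i t.

Lemma pr_solution i t : (i <= n)%N -> pr i (solution t) = x_ i t.
Proof.
move=> iN; apply: (@pr_sum_id (x_^~ t)) => // j jN.
by apply: flow_p (pr_mem _ _); rewrite leqnn.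
Qed.

Lemma solution0 : solution 0 = xbar.
Proof. by rewrite -[RHS]pr_sum; apply: eq_bigr => i _; exact: flow0. Qed.

Lemma solution_reduced : solves_reduced G n p s solution.
Proof.
have H i (t : R) : (i <= n)%N -> is_derive t 1 (pr i \o solution)
    (lie_bracket G (drift i t) (x_ i t)).
  move=> iN; have -> : pr i \o solution = x_ i by apply/funext => u; exact: pr_solution.
  apply: is_derive_eq (flow_is_derive i (is_derive_cst (pr i xbar) t 1)) _.
  by have [L LE] := flow_lin i t; rewrite LE linear0 add0r.
split=> [t|i t /andP[_ iN]].
  by have := H 0%N t (leq0n _); rewrite /drift big_geq// lie_bracket0l.
have := H i t iN; rewrite driftE pr_solution//.
suff -> : \sum_(0 <= j < i) (s i - s j) *: x_ j t =
    \sum_(0 <= j < i) (s i - s j) *: pr j (solution t) by [].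
by apply: eq_big_nat => j /andP[_ ji]; rewrite pr_solution// (leq_trans (ltnW ji)).
Qed.

Local Notation stepV k t :=
  (Ad (lie_exp G ((t * (s k.+1 - s k)) *: prs k xbar))^-1%g).

Fixpoint flowV (i : nat) (t : R) (v : 'rV[R]_d) :=
  if i is k.+1 then stepV k t (flowV k t v) else v.

Lemma flowK i t : cancel (flow i t) (flowV i t).
Proof. by elim: i => //= i IH v; rewrite IH AdK. Qed.

Lemma flowVK i t : cancel (flowV i t) (flow i t).
Proof. by elim: i => //= i IH v; rewrite AdVK IH. Qed.

(** Existence suffices: the value of the derivative is forced afterwards by the identity of
    [flowVK]. *)
Lemma flowV_derivable i (t : R) (w : R -> 'rV[R]_d) dw : is_derive t 1 w dw ->
  exists dw', is_derive t 1 (fun t => flowV i t (w t)) dw'.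
Proof.
move=> Hw; elim: i => [|i [dv Hv]]; first by exists dw.
eexists; rewrite /=; under eq_fun do rewrite -lie_expN -scalerA -scalerN.
exact: Ad_lie_exp_is_derive Hv.
Qed.

(* Variation of constants: flowV i (y_i) has derivative zero. *)
Lemma reduced_uniq y : solves_reduced G n p s y -> y 0 = xbar -> y =1 solution.
Proof.
move=> [y0' yi'] y0 t; rewrite -[LHS]pr_sum; apply: eq_big_nat => i /andP[_].
rewrite ltnS; move: t; elim/ltn_ind: i => i IH t iN.
(* The lower components already agree with the solution, so the i-th equation becomes linear with
   the known coefficient [drift]. *)
have dy (u : R) : is_derive u 1 (pr i \o y) (lie_bracket G (drift i u) (pr i (y u))).
  case: i IH iN => [_ _|i IH iN].
    by rewrite /drift big_geq// lie_bracket0l.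
  have := yi' i.+1 u iN; rewrite driftE.
  suff -> : \sum_(0 <= j < i.+1) (s i.+1 - s j) *: pr j (y u) =
    \sum_(0 <= j < i.+1) (s i.+1 - s j) *: x_ j u by [].
  apply: eq_big_nat => j /andP[_ ji]; rewrite IH//.
  exact: leq_trans (ltnW ji) iN.
pose w u := flowV i u (pr i (y u)).
have dw (u : R) : is_derive u 1 w 0.
  have [dv Hv] := flowV_derivable i (dy u).
  suff <- : dv = 0 by [].
  have H := flow_is_derive i Hv.
  have E : flow i u dv = 0.
    have := is_derive_uniq H (dy u) (fun u => flowVK i u (pr i (y u))).
    by rewrite /= flowVK => /eqP; rewrite -subr_eq0 addrK => /eqP.
  rewrite -[LHS](flowK i u) E.
  by rewrite -[RHS](flowK i u); congr flowV; have [L LE] := flow_lin i u; rewrite LE linear0.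
have wt : w t = w 0 by exact: derive0_cst.
rewrite -[LHS](flowVK i t) -/(w t) wt /w y0 /x_; congr flow.
by rewrite -[RHS](flowK i 0) flow0.
Qed.

(** * The reconstruction problem on the group *)

Section Reconstruction.
Variable gbar : G.

Let partial m t := (gbar * lie_exp G ((t * s n) *: xbar) *
  \prod_(k <- rev (iota m (n - m))) lie_exp G ((t * (s k - s k.+1)) *: prs k xbar))%g.

(** Descending induction on m. The factor e_m appended on the right changes the left velocity v into
    Ad e_m^-1 v + (s_m - s_{m+1}) xbar_{g_m}, and e_m^-1 is the exponential of the m-th step of
    [flow]. Reading velocities through [flow m] therefore leaves the first term unchanged and turns
    xbar_{g_m} into x_0 + ... + x_m. *)
Lemma partial_velocity m t : (m <= n)%N -> exists2 v, left_velocity (partial m) t v &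
  flow m t v = s n *: solution t - \sum_(m <= j < n) (s j.+1 - s j) *: xs_ j t.
Proof.
move=> mn; rewrite -(subKn mn); elim: (n - m)%N (leq_subr m n) => [_|k IH kn].
  exists (s n *: xbar).
    rewrite /partial subn0 subnn /= /left_velocity.
    under eq_fun do rewrite big_nil mulg1 -scalerA.
    rewrite big_nil mulg1 -scalerA; apply: left_velocity_mull; exact: lie_exp_velocity.
  by rewrite subn0 big_geq// subr0 flowZ -{1}(prs_last xbar) flow_prs.
have {IH} := IH (ltnW kn).
have : (n - k)%N = (n - k.+1).+1 by rewrite subnSK.
have : (n - k.+1 < n)%N by rewrite ltn_subrL; case: (n) kn.
move: (n - k.+1)%N => {mn kn}m' mn -> [v Hv fv].
pose e t := lie_exp G ((t * (s m' - s m'.+1)) *: prs m' xbar).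
have He : left_velocity e t ((s m' - s m'.+1) *: prs m' xbar).
  by have := lie_exp_velocity (G := G) ((s m' - s m'.+1) *: prs m' xbar) t;
    under eq_fun do rewrite scalerA.
have pE u : partial m' u = (partial m'.+1 u * e u)%g.
  by rewrite /partial -[in LHS](subnSK mn) /= rev_cons big_rcons/= mulgA.
exists (Ad (e t)^-1%g v + (s m' - s m'.+1) *: prs m' xbar).
  have -> : partial m' = (fun u => partial m'.+1 u * e u)%g by apply/funext.
  exact: left_velocity_mul.
rewrite flowD flowZ flow_prs.
have -> : (e t)^-1%g = lie_exp G ((t * (s m'.+1 - s m')) *: prs m' xbar).
  by rewrite /e -lie_expN -scaleNr -mulrN opprB.
(* By computation, [flow m'] after the m'-th step is [flow m'.+1], so the induction hypothesis
   applies as it stands. *)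
rewrite [X in X + _]fv [in RHS]big_ltn//.
move: (solution t) (\sum_(_ <= _ < _) _) => z z'.
by apply/rowP => j; rewrite !mxE; ring.
Qed.

(** Abel summation, with [xs_ j] as the partial sums of the [x_ j]. *)
Lemma chain_velocity_solution m t : (m <= n)%N ->
  s m *: xs_ m t - \sum_(0 <= j < m) (s j.+1 - s j) *: xs_ j t =
  \sum_(0 <= j < m.+1) s j *: x_ j t.
Proof.
elim: m => [|m IH] mn; first by rewrite /xs_ !big_nat1 big_geq// subr0.
rewrite [in RHS]big_nat_recr//= -IH ?(ltnW mn)// big_nat_recr//= /xs_.
rewrite (big_nat_recr m.+1)//= -/(xs_ m t) scalerDr scalerBl opprD opprB.
by apply/rowP => j; rewrite !mxE; ring.
Qed.

Lemma reconstruction_velocity t :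
  left_velocity (reconstruction n p s gbar xbar) t (chain_velocity (solution t)).
Proof.
have [v Hv fv] := partial_velocity t (leq0n n).
have -> : chain_velocity (solution t) = v.
  rewrite -[RHS]/(flow 0 t v) fv -/(xs_ n t) chain_velocity_solution//.
  by rewrite /chain_velocity; apply: eq_big_nat => i /andP[_ iN]; rewrite pr_solution.
by move: Hv; rewrite /partial subn0.
Qed.

Lemma reconstruction0 : reconstruction n p s gbar xbar 0 = gbar.
Proof.
rewrite /reconstruction mul0r scale0r lie_exp0 mulg1 big1 ?mulg1// => i _.
by rewrite mul0r scale0r lie_exp0.
Qed.

Lemma kinematicP (g : R -> G) : solves_kinematic n p s solution g /\ g 0 = gbar <->
  g =1 reconstruction n p s gbar xbar.
Proof.
split=> [[Hg g0] t|/funext ->]; last first.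
  split; last exact: reconstruction0.
  by move=> t; exact: reconstruction_velocity.
apply: (@left_velocity_eq _ _ _ g _ (fun t => chain_velocity (solution t)) (`|t| + 1)).
- by rewrite reconstruction0.
- by move=> u _; exact: Hg.
- by move=> u _; exact: reconstruction_velocity.
- by rewrite ltrDl.
Qed.

End Reconstruction.

Lemma reducedP y : solves_reduced G n p s y /\ y 0 = xbar <-> y =1 solution.
Proof.
split=> [[H y0]|/funext ->]; first exact: reduced_uniq.
by split; [exact: solution_reduced|exact: solution0].
Qed.

End Solution.

End Hamiltonian.

End OrthogonalChain.

Theorem theorem2 (R : realType) (d : nat) (G : lieGroupType R d)
    (n : nat) (gs p : nat -> {vspace 'rV[R]_d})
    (B : 'rV[R]_d -> 'rV[R]_d -> R) (s : nat -> R)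
    (G_connected : connected [set: G])
    (gs_subalgebra : forall i, (i <= n)%N -> lie_subalgebra G (gs i))
    (gs_strict : forall i, (i < n)%N ->
       (gs i <= gs i.+1)%VS /\ gs i <> gs i.+1)
    (gs_last : gs n = fullv)
    (B_cases :
       (compact [set: G] /\ invariant_scalar_product G B) \/
       [/\ lie_semisimple G,
           (forall v w, B v w = killing_form G v w)
         & forall i, (i <= n)%N -> nondegenerate_on B (gs i)])
    (p_zero : p 0%N = gs 0%N)
    (p_succ : forall i, (i < n)%N -> forall v,
       v \in p i.+1 <->
       v \in gs i.+1 /\ (forall w, w \in gs i -> B v w = 0)) :
  (forall (g : R -> G) (x : R -> 'rV[R]_d),
     hamiltonian_curve B (chain_hamiltonian n p s B) g x <->
     solves_reduced G n p s x /\ solves_kinematic n p s x g) /\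
  (forall xbar : 'rV[R]_d, exists x : R -> 'rV[R]_d,
     [/\ (forall y : R -> 'rV[R]_d,
            solves_reduced G n p s y /\ y 0 = xbar <-> y =1 x),
         (forall t, chain_pr n p 0 (x t) = chain_pr n p 0 xbar /\
                    chain_pr n p 0 (x t) = chain_sub n p 0 xbar),
         (forall i t, (0 < i <= n)%N ->
            chain_pr n p i (x t) =
            (\big[comp/id]_(0 <= k < i)
               Ad (lie_exp G ((t * (s k.+1 - s k)) *: chain_sub n p k xbar)))
            (chain_pr n p i xbar))
       & (forall (gbar : G) (g : R -> G),
            solves_kinematic n p s x g /\ g 0 = gbar <->
            g =1 reconstruction n p s gbar xbar)]).
Proof.
have [BP ndB] : invariant_form G B /\ forall i, (i <= n)%N -> nondegenerate_on B (gs i).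
  case: B_cases => [[_ [BL BC Bpos BA]]|[_ BK nd]].
    (* A positive definite form is nondegenerate on every subspace: v is tested against itself. *)
    split=> [//|i _ v vi Bv]; apply/eqP/negP => /negP/Bpos.
    by rewrite (Bv v vi) ltxx.
  split=> //; have -> : B = killing_form G by apply/funext => v; apply/funext => w.
  exact: killing_form_invariant.
have gs_sub i : (i < n)%N -> (gs i <= gs i.+1)%VS by move=> /gs_strict[].
split=> [g x|xbar].
  exact: (hamiltonian_curveP BP gs_subalgebra gs_sub gs_last ndB p_zero p_succ s g x).
have prE i t : (i <= n)%N ->
    chain_pr n p i (solution (G := G) n p s xbar t) =
    flow (G := G) n p s xbar i t (chain_pr n p i xbar).
  exact: (pr_solution BP gs_subalgebra gs_sub gs_last ndB p_zero p_succ s xbar).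
exists (solution (G := G) n p s xbar); split.
- exact: (reducedP BP gs_subalgebra gs_sub gs_last ndB p_zero p_succ s xbar).
- by move=> t; rewrite prE// /chain_sub big_nat1.
- by move=> i t /andP[_ iN]; rewrite prE// flowE.
- exact: (kinematicP BP gs_subalgebra gs_sub gs_last ndB p_zero p_succ s xbar).
Qed.
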